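(* Let $(W,S)$ be an arbitrary Coxeter system (not assumed finite) and let $w, x \in W$. The shifted lower Bruhat interval $[e,w]\,x^{-1} = \{\, vx^{-1} : v \le w \,\}$, partially ordered by the restriction of the Bruhat order of $W$, is EL-shellable.
   Context: $(W,S)$ is a Coxeter system with identity $e$; $\le$ denotes the Bruhat order on $W$. EL-labeling: let $P$ be a finite graded poset with minimum $\hat 0$ and maximum $\hat 1$, and let $\lambda$ be a map from the cover relations of $P$ to a totally ordered set $(\Lambda,\prec)$. A maximal chain $p=c_0\lessdot c_1\lessdot\cdots\lessdot c_k=q$ of an interval $[p,q]$ is increasing if $\lambda(c_0\lessdot c_1)\prec\lambda(c_1\lessdot c_2)\prec\cdots\prec\lambda(c_{k-1}\lessdot c_k)$; maximal chains of $[p,q]$ are compared in the lexicographic order on their label sequences. The map $\lambda$ is an EL-labeling if every interval $[p,q]$ of $P$ has a unique increasing maximal chain, and this chain is lexicographically first among the maximal chains of $[p,q]$. A bounded graded poset admitting an EL-labeling is called EL-shellable. *)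

(* Defs.v *)
From mathcomp Require Import all_boot all_order.
From mathcomp Require Import boolp classical_sets cardinality.
From Stdlib Require Import Relation_Operators.

Set Implicit Arguments.
Unset Strict Implicit.
Unset Printing Implicit Defensive.

Import Order.TTheory.

Local Open Scope order_scope.
Local Open Scope group_scope.
Local Open Scope classical_set_scope.

Section Presentation.

(* The letter (i, b) stands for the generator i if b = false, and for its
   formal inverse if b = true. *)
Definition word (I : Type) := seq (I * bool).

(* The words modulo [word_equiv R] form the free group on I divided by the
   normal closure of R. *)
Inductive word_equiv (I : Type) (R : set (word I)) : word I -> word I -> Prop :=
| word_equiv_refl u : word_equiv R u u
| word_equiv_sym u v : word_equiv R u v -> word_equiv R v u
| word_equiv_trans u v w :
    word_equiv R u v -> word_equiv R v w -> word_equiv R u w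
| word_equiv_cancel u v i b :
    word_equiv R (u ++ [:: (i, b); (i, ~~ b)] ++ v) (u ++ v)
| word_equiv_relator u v r : R r -> word_equiv R (u ++ r ++ v) (u ++ v).

Definition word_eval (I : Type) (G : groupType) (f : I -> G) (u : word I) : G :=
  \prod_(l <- u) (if l.2 then (f l.1)^-1 else f l.1).

(* G = < f i, i : I | R >: the evaluation map from the free group on I to G is
   onto, and its kernel is the normal closure of R. *)
Definition presents (I : Type) (G : groupType) (f : I -> G)
    (R : set (word I)) : Prop :=
  (forall g, exists u, word_eval f u = g) /\
  (forall u, word_eval f u = 1 <-> word_equiv R u [::]).

End Presentation.

Section Coxeter.

(* The value 0 encodes m(s, t) = oo. *)
Definition coxeter_matrix (I : Type) (m : I -> I -> nat) : Prop :=
  [/\ forall s, m s s = 1%N,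
      forall s t, m s t = m t s &
      forall s t, s <> t -> m s t <> 1%N].

(* The words (s t)^m(s, t); for m(s, t) = oo this is the empty word, which
   imposes no relation. *)
Definition coxeter_relators (I : Type) (m : I -> I -> nat) : set (word I) :=
  [set r | exists s t, r = flatten (nseq (m s t) [:: (s, false); (t, false)])].

Definition coxeter_system (W : groupType) (S : set W) : Prop :=
  exists m : S -> S -> nat,
    coxeter_matrix m /\ presents (fun s : S => val s) (coxeter_relators m).

Definition has_word_of_size (W : groupType) (S : set W) (w : W) (n : nat) :=
  exists u : seq S, size u = n /\ \prod_(s <- u) val s = w.

Definition cox_length (W : groupType) (S : set W) (w : W) : nat :=
  xget 0%N [set n | has_word_of_size S w n /\
                    forall k, has_word_of_size S w k -> (n <= k)%N].

Definition reflections (W : groupType) (S : set W) : set W :=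
  [set s ^ g | s in S & g in [set: W]].

Definition bruhat_step (W : groupType) (S : set W) (u v : W) : Prop :=
  exists2 t, reflections S t & v = u * t /\ (cox_length S u < cox_length S v)%N.

Definition bruhat (W : groupType) (S : set W) : W -> W -> Prop :=
  clos_refl_trans W (bruhat_step S).

Definition shifted_lower_interval (W : groupType) (S : set W) (w x : W) :
    set W :=
  [set v * x^-1 | v in [set v | bruhat S v w]].

End Coxeter.

(* A poset is given by a subset P of a type T and a relation le on T, of which
   only the restriction to P matters. *)
Section Poset.
Variables (T : Type) (P : set T) (le : T -> T -> Prop).

Definition partial_order_on : Prop :=
  [/\ forall p, P p -> le p p,
      forall p q, P p -> P q -> le p q -> le q p -> p = q &
      forall p q r, P p -> P q -> P r -> le p q -> le q r -> le p r].

Definition is_minimum (b : T) : Prop := P b /\ forall p, P p -> le b p.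

Definition is_maximum (t : T) : Prop := P t /\ forall p, P p -> le p t.

Definition lt_in (p q : T) : Prop := [/\ P p, P q, le p q & p <> q].

Definition covers (p q : T) : Prop :=
  lt_in p q /\ forall r, ~ (lt_in p r /\ lt_in r q).

(* The maximal chain p = c_0 <. c_1 <. ... <. c_k = q is represented by its
   starting point p and the sequence c = [:: c_1; ...; c_k]. *)
Definition maximal_chain (p q : T) (c : seq T) : Prop :=
  path (fun a b => `[< covers a b >]) p c /\ last p c = q.

Definition bounded_graded (b t : T) : Prop :=
  [/\ is_minimum b, is_maximum t &
      forall c c', maximal_chain b t c -> maximal_chain b t c' ->
        size c = size c'].

Section Labeling.
Variables (d : Order.disp_t) (L : orderType d).
(* Only the values of lam on the pairs (p, q) with covers p q are used. *)
Variable lam : T -> T -> L.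

Definition label_seq (p : T) (c : seq T) : seq L := pairmap lam p c.

Definition increasing_chain (p : T) (c : seq T) : Prop :=
  sorted (fun a b : L => a < b) (label_seq p c).

Definition lex_le (p : T) (c c' : seq T) : Prop :=
  (label_seq p c : seqlexi L) <= (label_seq p c' : seqlexi L).

Definition EL_labeling : Prop :=
  forall p q, P p -> P q -> le p q ->
    exists c, [/\ maximal_chain p q c,
                  increasing_chain p c,
                  forall c', maximal_chain p q c' -> increasing_chain p c' ->
                    c' = c &
                  forall c', maximal_chain p q c' -> lex_le p c c'].

End Labeling.

Definition EL_shellable : Prop :=
  [/\ partial_order_on,
      finite_set P,
      exists b t, bounded_graded b t &
      exists (d : Order.disp_t) (L : orderType d) (lam : T -> T -> L),
        EL_labeling lam].

End Poset.

(* Main.v *)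
Require Import Defs.
From mathcomp Require Import all_boot all_order all_algebra.
From mathcomp Require Import Rstruct boolp classical_sets cardinality reals trigo.
From mathcomp Require Import zify ring lra.
From Stdlib Require Import Relation_Operators.

Set Implicit Arguments.
Unset Strict Implicit.
Unset Printing Implicit Defensive.

Import Order.TTheory GRing.Theory Num.Theory.
Local Open Scope ring_scope.

(** Put y = x^-1, so that the poset consists of the v y with v <= w. Label the
    cover a <. b by the reflection a^-1 b, and order the reflections by a
    reflection order in which those with l(y t) < l(y) come first.

    For the whole Bruhat order, Dyer's theorem says that such labels are an
    EL-labeling: between p <= q there is exactly one saturated chain with
    increasing labels, and it is lexicographically first. Let c be the
    increasing chain from u y to v y, where u, v <= w, and multiply it by y^-1
    on the right. A step of c by a reflection t becomes a step down when
    l(y t) < l(y), and a step up otherwise ([shift_step]). The steps of the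
    first kind come first, so the chain descends from u and then ascends to v:
    it never leaves [e, w] ([increasing_chain_shift]). Hence the increasing
    chains of the Bruhat order are available in the shifted interval, the
    covers of the shifted interval are Bruhat covers, its maximal chains are
    graded by the length, and uniqueness and lexicographic minimality are
    inherited. A minimum and a maximum exist because for s w < w the interval
    [e, w] is the union of [e, s w] and s [e, s w], and the lifting property
    tells how this changes the extremal elements ([shifted_interval_bounds]).

    The reflection order comes from the contragredient of the geometric
    representation. A root is a linear form there; its slope is the quotient of
    its values at a chosen point and at a point of the fundamental chamber, and
    reflections are compared by the slopes of their roots. Two properties of
    this order carry the proof.

    For a simple reflection s, the label m(y) = y^-1 s y of the edge from y to
    s y changes along a step y -> y t by adding a multiple of the root of t to
    the root of m(y). This preserves the determinant of the two roots at the
    two points, so it is controlled by signs on which side of t the label m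
    lies ([slope_transport]). An induction along the list of reflections then
    shows that the numbers of increasing paths from p to z and from p to s z
    agree when s raises p and z, and those from p and s p to s z also agree
    ([count_paths_gen]). With the lifting property this reduces the count to
    shorter q, and it is always one ([count_paths1]).

    For a threshold at a given slope, a suitable height coordinate of the
    representation increases along steps whose slope is below the threshold,
    and decreases along those above it. So in an interval of length two the
    labels of a decreasing chain cannot both precede those of the increasing
    one ([rank2_slopes]), which makes the first label of an increasing chain
    the smallest one available ([increasing_chain_first]). *)

(** * Chebyshev numbers *)

(** The numbers sin (j theta) / sin theta for theta = pi / m, or their limits j
    when m = 0 stands for an infinite order. They are the coefficients of the
    roots in a dihedral group of order 2 m, and [c] is cos theta. *)
Definition chebyshev_data (R : realType) (m : nat) (c : R) (a : nat -> R) :=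
  [/\ a 0%N = 0 /\ a 1%N = 1,
      forall j, a j.+2 = 2 * c * a j.+1 - a j,
      forall j, (0 < j)%N -> m = 0%N \/ (j < m)%N -> 0 < a j &
      (0 < m)%N ->
        [/\ c ^+ 2 != 1, a m = 0, a (2 * m)%N = 0 & a (2 * m).+1 = 1]].

Lemma chebyshev_exists (R : realType) (m : nat) :
  m != 1%N -> exists c : R, exists a, chebyshev_data m c a.
Proof.
case: (posnP m) => [-> _|m_gt0 m_neq1].
  exists 1, (fun j => j%:R); split=> //; first by move=> j; rewrite -!natr1; ring.
  by move=> j j_gt0 _; rewrite ltr0n.
have mR_gt0 : 0 < m%:R :> R by rewrite ltr0n.
have m_gt1 : 1 < m%:R :> R by rewrite ltr1n; lia.
pose th := pi / m%:R : R.
have pi0 := pi_gt0 R.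
have th_m : th * m%:R = pi by rewrite /th divfK // gt_eqF.
have angle_pos j : (0 < j)%N -> (j < m)%N -> 0 < sin (th * j%:R).
  move=> j_gt0 j_lt; apply: sin_gt0_pi; rewrite mulr_gt0 ?divr_gt0 ?ltr0n //=.
  by rewrite -th_m ltr_pM2l ?divr_gt0 // ltr_nat.
have s_gt0 : 0 < sin th by have := angle_pos 1%N isT; rewrite mulr1; apply; lia.
have s_neq0 : sin th != 0 by rewrite gt_eqF.
exists (cos th), (fun j => sin (th * j%:R) / sin th); split.
- by rewrite mulr0 sin0 mul0r mulr1 divff.
- move=> j.
  have -> : th * j.+2%:R = th * j.+1%:R + th by rewrite -(natr1 j.+1); ring.
  have -> : th * j%:R = th * j.+1%:R - th by rewrite -(natr1 j); ring.
  by rewrite sinD sinB; field.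
- move=> j j_gt0 [|j_lt]; first by lia.
  by rewrite divr_gt0 // angle_pos.
- move=> _; rewrite th_m sinpi mul0r.
  have -> : th * (2 * m)%N%:R = pi *+ 2.
    by rewrite natrM -mulr_natr -th_m; ring.
  have -> : th * (2 * m).+1%:R = th + pi *+ 2.
    by rewrite -natr1 natrM mulrDr -mulr_natr -th_m; ring.
  rewrite sin2pi mul0r sinD2pi divff //; split=> //.
  have := cos2Dsin2 th; apply: contra_eq_neq => ->.
  by rewrite gt_eqF // ltrDl exprn_gt0.
Qed.

(** * Coxeter groups through their presentation *)

Local Open Scope group_scope.

Section WordAction.

Variables (W : groupType) (S : set W) (m : S -> S -> nat).
Hypothesis mP : presents (fun s : S => val s) (coxeter_relators m).

Variables (X : Type) (a : S -> X -> X).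
Hypothesis a_invol : forall s x, a s (a s x) = x.
Hypothesis a_braid : forall s t x, iter (m s t) (a s \o a t) x = x.

Let acts (u : word S) (x : X) := foldr (fun l => a l.1) x u.

Let acts_cat u v x : acts (u ++ v) x = acts u (acts v x).
Proof. exact: foldr_cat. Qed.

Let acts_relator r x : coxeter_relators m r -> acts r x = x.
Proof.
move=> [s [t ->]]; rewrite -[RHS](a_braid s t).
by elim: (m s t) => //= n <-.
Qed.

Let acts_equiv u v :
  word_equiv (coxeter_relators m) u v -> forall x, acts u x = acts v x.
Proof.
elim=> // [u1 v1 w _ IH1 _ IH2 x|u1 v1 i b x|u1 v1 r Rr x].
- by rewrite IH1 IH2.
- by rewrite !acts_cat /= a_invol.
- by rewrite !acts_cat (acts_relator _ Rr).
Qed.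

Let word_inv (u : word S) : word S := rev [seq (l.1, ~~ l.2) | l <- u].

Let eval_cat u v : word_eval (fun s : S => val s) (u ++ v) =
  word_eval (fun s : S => val s) u * word_eval (fun s : S => val s) v.
Proof. exact: big_cat. Qed.

Let eval_inv u : word_eval (fun s : S => val s) (word_inv u) =
  (word_eval (fun s : S => val s) u)^-1.
Proof.
rewrite /word_inv; elim: u => [|[i b] u IH].
  by rewrite /word_eval !big_nil invg1.
rewrite /= rev_cons -cats1 eval_cat IH.
rewrite -[(i, b) :: u]cat1s (eval_cat [:: _] u) invgM; congr (_ * _).
by rewrite /word_eval !big_seq1; case: b => //=; rewrite invgK.
Qed.

Let acts_inv u x : acts u (acts (word_inv u) x) = x.
Proof.
rewrite /word_inv; elim: u x => //= [[i b]] u IH x.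
by rewrite rev_cons -cats1 acts_cat IH /= a_invol.
Qed.

Let acts_eval u v : word_eval (fun s : S => val s) u =
  word_eval (fun s : S => val s) v -> forall x, acts u x = acts v x.
Proof.
move=> uv x.
have invK v' : word_eval (fun s : S => val s) v' =
    word_eval (fun s : S => val s) v -> acts (word_inv v) (acts v' x) = x.
  move=> v'v; rewrite -acts_cat; apply: (@acts_equiv _ [::]).
  by apply/(proj2 mP); rewrite eval_cat eval_inv v'v mulVg.
by rewrite -(acts_inv v (acts u x)) invK // -[in LHS](invK v).
Qed.

(** A word that evaluates to 1 is equivalent to the empty word, hence acts
    trivially; so the action of a word depends only on its value. *)
Lemma coxeter_action : exists rep : W -> X -> X,
  [/\ forall x, rep 1 x = x,
      forall g h x, rep (g * h) x = rep g (rep h x) &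
      forall s x, rep (val s) x = a s x].
Proof.
have [wd wdP] := choice (proj1 mP).
exists (fun w => acts (wd w)); split.
- by move=> x; rewrite (@acts_eval _ [::]) // wdP /word_eval big_nil.
- by move=> g h x; rewrite -acts_cat; apply: acts_eval; rewrite eval_cat !wdP.
- move=> s x; rewrite (@acts_eval _ [:: (s, false)]) //.
  by rewrite wdP /word_eval big_seq1.
Qed.

End WordAction.

Section Length.

Variables (W : groupType) (S : set W).
Hypothesis coxS : coxeter_system S.

Local Notation len := (cox_length S).

Lemma gen_invol (s : S) : val s * val s = 1.
Proof.
have [m [[m1 _ _] [_ mP]]] := coxS.
have -> : val s * val s =
    word_eval (fun s : S => val s) [:: (s, false); (s, false)].
  by rewrite /word_eval !big_cons big_nil mulg1.
apply/mP; apply: (@word_equiv_relator _ _ [::] [::] [:: (s, false); (s, false)]).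
by exists s, s; rewrite m1.
Qed.

Lemma gen_inv (s : S) : (val s)^-1 = val s.
Proof. exact: mulg1_eq (gen_invol s). Qed.

Lemma genK (s : S) (w : W) : val s * (val s * w) = w.
Proof. by rewrite mulgA gen_invol mul1g. Qed.

Lemma mulg_genK (s : S) (w : W) : w * val s * val s = w.
Proof. by rewrite -mulgA gen_invol mulg1. Qed.

Lemma word_exists (w : W) : exists u : seq S, \prod_(s <- u) val s = w.
Proof.
have [m [_ [onto _]]] := coxS; have [u <-] := onto w.
exists [seq l.1 | l <- u]; rewrite big_map; apply: eq_bigr => -[s []] //= _.
by rewrite gen_inv.
Qed.

(** Every element is a product of generators, so the set of word sizes has a
    least element. *)
Lemma lenP (w : W) : has_word_of_size S w (len w) /\
  forall k, has_word_of_size S w k -> (len w <= k)%N.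
Proof.
have [u uw] := word_exists w.
have ex : exists n, `[< has_word_of_size S w n >].
  by exists (size u); apply/asboolP; exists u.
apply: (xgetPex 0%N (P := [set n | has_word_of_size S w n /\
  forall k, has_word_of_size S w k -> (n <= k)%N])).
exists (ex_minn ex); case: ex_minnP => n /asboolP n_word n_min; split=> // k wk.
by apply: n_min; apply/asboolP.
Qed.

Lemma reduced_word (w : W) :
  exists u : seq S, size u = len w /\ \prod_(s <- u) val s = w.
Proof. exact: (proj1 (lenP w)). Qed.

Lemma len_prod (u : seq S) : (len (\prod_(s <- u) val s) <= size u)%N.
Proof. by apply: (proj2 (lenP _)); exists u. Qed.

Lemma len1 : len 1 = 0%N.
Proof. by apply/eqP; rewrite -leqn0; have := len_prod [::]; rewrite big_nil. Qed.

Lemma len_eq0 w : len w = 0%N -> w = 1.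
Proof.
move=> w0; have [u [sz uw]] := reduced_word w.
by move: sz uw; rewrite w0 => /size0nil ->; rewrite big_nil.
Qed.

Lemma len_mul g h : (len (g * h) <= len g + len h)%N.
Proof.
have [u [<- <-]] := reduced_word g; have [v [<- <-]] := reduced_word h.
by rewrite -big_cat -size_cat len_prod.
Qed.

Lemma len_gen_le1 (s : S) : (len (val s) <= 1)%N.
Proof. by have := len_prod [:: s]; rewrite big_seq1. Qed.

Lemma len_inv w : len w^-1 = len w.
Proof.
have le x : (len x^-1 <= len x)%N.
  have [u [<- <-]] := reduced_word x; elim: u => [|s u IH].
    by rewrite big_nil invg1 len1.
  rewrite big_cons invgM gen_inv; apply: leq_trans (len_mul _ _) _.
  by rewrite /= -addn1 leq_add // len_gen_le1.
by apply/eqP; rewrite eqn_leq le -{1}(invgK w) le.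
Qed.

(** Every defining relator has even length, so the generators may all act as
    the negation of booleans. *)
Lemma sign_character : exists sgn : W -> bool,
  (forall g h, sgn (g * h) = sgn g (+) sgn h) /\
  (forall s : S, sgn (val s) = true).
Proof.
have [m [_ mP]] := coxS.
have [|s t b|act [act1 actM act_gen]] :=
  @coxeter_action W S m mP bool (fun _ => negb).
- by move=> _; exact: negbK.
- by elim: (m s t) => //= n ->; rewrite negbK.
have act_sgn w b : act w b = act w false (+) b.
  have [u <-] := word_exists w; elim: u b => [|s u IH] b.
    by rewrite big_nil !act1.
  by rewrite big_cons !actM !act_gen IH -addNb.
exists (fun w => act w false); split=> [g h|s]; last by rewrite act_gen.
by rewrite actM act_sgn.
Qed.

(** A generator is not 1, because it has sign -1. *)
Lemma len_gen (s : S) : len (val s) = 1%N.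
Proof.
have := len_gen_le1 s; case E : (len (val s)) => [|[|//]] // _.
have [sgn [sgnM /(_ s)]] := sign_character; rewrite (len_eq0 E).
by have := sgnM 1 1; rewrite mulg1; case: (sgn 1).
Qed.

Lemma odd_len_mul g h : odd (len (g * h)) = odd (len g) (+) odd (len h).
Proof.
have [sgn [sgnM sgn_gen]] := sign_character.
have sgn1 : sgn 1 = false by have := sgnM 1 1; rewrite mulg1; case: (sgn 1).
suff sgn_len w : sgn w = odd (len w) by rewrite -!sgn_len sgnM.
have [u [<- <-]] := reduced_word w; elim: u => [|s u IH]; first by rewrite big_nil.
by rewrite big_cons sgnM sgn_gen IH addTb.
Qed.

Lemma len_genL (s : S) w :
  len (val s * w) = (len w).+1 \/ len w = (len (val s * w)).+1.
Proof.
have := odd_len_mul (val s) w; rewrite len_gen.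
have := len_mul (val s) w; rewrite len_gen.
have := len_mul (val s) (val s * w); rewrite genK len_gen; lia.
Qed.

Lemma len_genL_lt (s : S) w : (len w < len (val s * w))%N ->
  len (val s * w) = (len w).+1.
Proof. by case: (len_genL s w) => // ->; lia. Qed.

Lemma len_genL_gt (s : S) w : (len (val s * w) < len w)%N ->
  len w = (len (val s * w)).+1.
Proof. by case: (len_genL s w) => // ->; lia. Qed.

Lemma len_genL_ltN (s : S) w :
  (len (val s * w) < len w)%N = ~~ (len w < len (val s * w))%N.
Proof. by have := len_genL s w; lia. Qed.

Lemma left_descent w : w <> 1 -> exists s : S, (len (val s * w) < len w)%N.
Proof.
have [[|s u] [sz uw]] := reduced_word w; first by rewrite -uw big_nil.
move=> _; exists s; rewrite -sz -uw big_cons genK /=.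
by rewrite ltnS len_prod.
Qed.

End Length.

(** * The contragredient geometric representation *)

(** A vector assigns to [Some t] the value of a linear form at the simple root
    t, so that no finiteness condition is needed when S is infinite. The extra
    coordinate [None] has the value 1 at every simple coroot: it measures the
    height of a sum of coroots even when these are linearly dependent, as they
    are in affine groups. *)
Record geometric_rep (R : realType) (W : groupType) (S : set W) := GeometricRep {
  coroot_of : S -> option S -> R;
  rep_act : W -> (option S -> R) -> option S -> R;
  coroot_diag : forall s, coroot_of s (Some s) = 2%:R;
  coroot_height : forall s, coroot_of s None = 1%R;
  rep1 : forall f, rep_act 1 f = f;
  repM : forall g h f, rep_act (g * h) f = rep_act g (rep_act h f);
  rep_gen : forall s f u,
    rep_act (val s) f u = (f u - f (Some s) * coroot_of s u)%R;
  rep_gt0 : forall y (s : S) f,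
    (cox_length S y < cox_length S (val s * y))%N ->
    (forall t, 0 < f (Some t))%R -> (0 < rep_act y f (Some s))%R
}.

Section Construction.

Variables (R : realType) (W : groupType) (S : set W) (m : S -> S -> nat).
Hypotheses (mM : coxeter_matrix m).
Hypothesis mP : presents (fun s : S => val s) (coxeter_relators m).

Local Notation len := (cox_length S).

Let coxS : coxeter_system S.
Proof. by exists m. Qed.

Variables (c : nat -> R) (a : nat -> nat -> R).
Hypothesis ca : forall n, n != 1%N -> chebyshev_data n (c n) (a n).

Let msym s t : m s t = m t s. Proof. by case: mM. Qed.
Let mdiag s : m s s = 1%N. Proof. by case: mM. Qed.
Let mneq1 s t : s != t -> m s t != 1%N.
Proof. by move=> /eqP st; case: mM => _ _ /(_ _ _ st)/eqP. Qed.

Local Open Scope ring_scope.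

Let cr (s : S) (u : option S) : R :=
  if u is Some t then if s == t then 2 else - (2 * c (m s t)) else 1.

Let act (s : S) (f : option S -> R) : option S -> R :=
  fun u => f u - f (Some s) * cr s u.

Let cr_diag s : cr s (Some s) = 2.
Proof. by rewrite /cr eqxx. Qed.

Let cr_neq s t : s != t -> cr s (Some t) = - (2 * c (m s t)).
Proof. by rewrite /cr => /negPf ->. Qed.

Let act_invol s f : act s (act s f) = f.
Proof. by apply/funext => u; rewrite /act cr_diag; ring. Qed.

Let act_neq s t f : s != t ->
  act s f (Some t) = f (Some t) + 2 * c (m s t) * f (Some s).
Proof. by move=> st; rewrite /act cr_neq //; ring. Qed.

Let act_eq s f : act s f (Some s) = - f (Some s).
Proof. by rewrite /act cr_diag; ring. Qed.

(** The alternating values at t and s satisfy the recursion of the Chebyshev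
    numbers, so they return after 2 m steps. Every other coordinate changes by
    multiples of the sums O and E of the values at t and at s; both vanish,
    since E = c O and O = c E with c different from 1 and -1. *)
Let act_braid s t f : iter (m s t) (act s \o act t) f = f.
Proof.
have [<-|st] := eqVneq s t; first by rewrite mdiag /= act_invol.
have ts : t != s by rewrite eq_sym.
have [[a0 a1] aSS _ a_per] := ca (mneq1 st).
have [-> //|m_gt0] := posnP (m s t); have [c2 _ am am1] := a_per m_gt0.
pose k := 2 * c (m s t); pose x0 := f (Some t); pose y0 := f (Some s).
pose g n := iter n (act s \o act t) f.
have key n : exists O E,
  [/\ forall u, g n u = f u - O * cr t u - E * cr s u,
      k * O = 2 * E + g n (Some s) - y0,
      k * E = 2 * O + g n (Some t) - x0,
      g n (Some t) = x0 * a (m s t) (2 * n).+1 + y0 * a (m s t) (2 * n)%N &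
      g n (Some s) = - (x0 * a (m s t) (2 * n)%N +
        y0 * (k * a (m s t) (2 * n)%N - a (m s t) (2 * n).+1))].
  elim: n => [|n [O [E [gu kO kE gt gs]]]].
    exists 0, 0; rewrite /g /= muln0 a0 a1 /x0 /y0.
    by split=> *; ring.
  pose x := g n (Some t); pose y := g n (Some s).
  have gtS : g n.+1 (Some t) = k * (y + k * x) - x.
    by rewrite /g iterS /= act_neq // act_eq act_neq // (msym t s) /x /y /g /k; ring.
  have gsS : g n.+1 (Some s) = - (y + k * x).
    by rewrite /g iterS /= act_eq act_neq // (msym t s).
  have guS u : g n.+1 u = g n u - x * cr t u - (y + k * x) * cr s u.
    by rewrite /g iterS /= {1}/act act_neq // (msym t s) {1}/act.
  exists (O + x), (E + (y + k * x)); rewrite gtS gsS mulnS addSn add1n.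
  rewrite !aSS -/k; split.
  - by move=> u; rewrite guS gu; ring.
  - by rewrite mulrDr kO -/y; ring.
  - by rewrite mulrDr kE -/x; ring.
  - by rewrite /x /y gt gs; ring.
  - by rewrite /x /y gt gs; ring.
have [O [E [gu kO kE gt gs]]] := key (m s t).
move: kO kE; rewrite gt gs am am1 => kO kE.
have OE : E = c (m s t) * O by move: kO; rewrite /k /x0 /y0; lra.
have EO : O = c (m s t) * E by move: kE; rewrite /k /x0 /y0; lra.
have O0 : O = 0.
  have : (c (m s t) ^+ 2 - 1) * O = 0 by rewrite mulrBl mul1r expr2 -mulrA -OE -EO subrr.
  by move/eqP; rewrite mulf_eq0 subr_eq0 (negPf c2) => /eqP.
by apply/funext => u; have := gu u; rewrite /g OE O0; rewrite !(mulr0, mul0r, subr0).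
Qed.

Local Open Scope group_scope.

Let gen_relation (s t : S) : (val s * val t) ^+ m s t = 1.
Proof.
have <- : word_eval (fun s : S => val s)
    (flatten (nseq (m s t) [:: (s, false); (t, false)])) =
    (val s * val t) ^+ m s t.
  elim: (m s t) => [|n IH]; first by rewrite /word_eval big_nil.
  by rewrite expgS -IH /word_eval /= !big_cons mulgA.
apply/(proj2 mP); rewrite -[flatten _]cats0.
by apply: (@word_equiv_relator _ _ [::] [::]); exists s, t.
Qed.

(** The alternating product s t s t ... with n factors. *)
Fixpoint alt_prod n (s t : S) : W :=
  if n is n'.+1 then val s * alt_prod n' t s else 1.

Let alt_rcons n s t :
  alt_prod n.+1 s t = alt_prod n s t * val (if odd n then t else s).
Proof.
elim: n s t => [|n IH] s t; first by rewrite /= mulg1 mul1g.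
have -> : alt_prod n.+2 s t = val s * alt_prod n.+1 t s by [].
by rewrite IH /= mulgA; case: (odd n).
Qed.

Let alt_even n s t : alt_prod n.*2 s t = (val s * val t) ^+ n.
Proof. by elim: n => // n IH; rewrite doubleS /= IH mulgA -expgS. Qed.

Let alt_odd n s t : alt_prod n.*2.+1 s t = (val s * val t) ^+ n * val s.
Proof. by rewrite alt_rcons alt_even odd_double. Qed.

Let len_alt n s t : (len (alt_prod n s t) <= n)%N.
Proof.
elim: n s t => [|n IH] s t; first by rewrite len1.
by apply: leq_trans (len_mul coxS _ _) _; rewrite len_gen // ltnS IH.
Qed.

Let inv_gen2 (s t : S) : (val s * val t)^-1 = val t * val s.
Proof. by rewrite invgM !gen_inv. Qed.

Let alt_braid s t : alt_prod (m s t) s t = alt_prod (m s t) t s.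
Proof.
have := gen_relation s t; rewrite -(odd_double_half (m s t)).
case: (odd _); set n := _./2; rewrite ?add1n ?add0n => E.
  have {}E : (val s * val t) ^+ n * val s * (val t * (val s * val t) ^+ n) = 1.
    by rewrite mulgA -(mulgA _ (val s)) -expgSr -expgnDr addSn addnn.
  rewrite !alt_odd; apply: (mulIg (val t * (val s * val t) ^+ n)).
  rewrite E -mulgA genK // -(inv_gen2 s t) expVgn mulVg //.
rewrite !alt_even -(inv_gen2 s t) expVgn; apply: (mulIg ((val s * val t) ^+ n)).
by rewrite mulVg -expgnDr addnn.
Qed.

Section Positivity.

Variable rp : W -> (option S -> R) -> option S -> R.
Hypothesis rp1 : forall f, rp 1 f = f.
Hypothesis rpM : forall g h f, rp (g * h) f = rp g (rp h f).
Hypothesis rp_gen : forall s f, rp (val s) f = act s f.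

(** The letter with index j in the alternating sequence s, t, s, t, ... *)
Definition alt_letter j (s t : S) := if odd j then t else s.

Let alt_letterS j s t : alt_letter j.+1 s t = alt_letter j t s.
Proof. by rewrite /alt_letter /=; case: (odd j). Qed.

(** Write y0 = d y with d alternating in s and t and lengths adding up. Pulling
    the coordinate s of y0 f back along d gives a combination of the coordinates
    of y f at the two letters, with Chebyshev numbers as coefficients. Letters
    are split off until neither lowers y, and then [IH0] applies to y. The word
    d cannot reach length m, or it could be rewritten to start with s, which is
    impossible as s raises y0. *)
Lemma dihedral_descent (s t : S) (y0 : W) f : s != t ->
    (len y0 < len (val s * y0))%N -> (len (val t * y0) < len y0)%N ->
    (forall y u, (len y < len y0)%N -> (len y < len (val u * y))%N ->
      (0 < rp y f (Some u))%R) ->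
  forall n j y p q, p = alt_letter j s t -> q = alt_letter j t s ->
    len y = n -> y0 = alt_prod j t s * y -> len y0 = (j + len y)%N ->
    (len y < len (val p * y))%N -> m s t = 0%N \/ (j < m s t)%N ->
  (0 < a (m s t) j.+1 * rp y f (Some p) + a (m s t) j * rp y f (Some q))%R.
Proof.
move=> st sy0 ty0 IH0; have [[a0 a1] aSS a_gt0 a_per] := ca (mneq1 st).
have a_ge0 j : m s t = 0%N \/ (j < m s t)%N -> (0 <= a (m s t) j.+1)%R.
  move=> [m0|jm]; first by rewrite ltW // a_gt0 //; left.
  have [jm1|] := ltnP j.+1 (m s t); first by rewrite ltW // a_gt0 //; right.
  move=> mj; have -> : j.+1 = m s t by lia.
  by have [|_ -> _ _] := a_per; first by lia.
elim/ltn_ind=> n IH j y p q Ep Eq ny Ey0 ly0 py jm.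
have [qy|yq] := ltnP (len y) (len (val q * y)).
  have j_gt0 : (0 < j)%N.
    rewrite lt0n; apply/eqP => j0; move: qy Ey0; rewrite Eq j0 /= mul1g => qy y0y.
    by move: ty0; rewrite y0y => /(ltn_trans qy); rewrite ltnn.
  have ly : (len y < len y0)%N by lia.
  have [pos_p pos_q] := (IH0 _ _ ly py, IH0 _ _ ly qy).
  apply: ltr_wpDl; last by rewrite mulr_gt0 // a_gt0.
  by apply: mulr_ge0; [exact: a_ge0|exact: ltW].
have qy : (len (val q * y) < len y)%N by rewrite len_genL_ltN // -leqNgt.
have ly := len_genL_gt coxS qy; set y' := val q * y in qy ly.
have Ey : y = val q * y' by rewrite genK.
have altE : alt_prod j.+1 t s * y' = y0.
  by rewrite alt_rcons Ey0 -mulgA [in RHS]Ey Eq.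
have pq : p != q by rewrite Ep Eq /alt_letter; case: (odd j); rewrite // eq_sym.
have mpq : m p q = m s t by rewrite Ep Eq /alt_letter; case: (odd j).
have jm' : m s t = 0%N \/ (j.+1 < m s t)%N.
  case: jm => [->|jm]; [by left|right]; rewrite ltn_neqAle jm andbT.
  apply/eqP => mj; move: altE; rewrite mj msym alt_braid (msym t s) -mj => Ey0'.
  have : (len (val s * y0) <= j + len y')%N.
    rewrite -Ey0' /= mulgA genK //; apply: leq_trans (len_mul coxS _ _) _.
    by rewrite leq_add2r len_alt.
  lia.
have H : (0 < a (m s t) j.+2 * rp y' f (Some q) + a (m s t) j.+1 * rp y' f (Some p))%R.
  apply: (IH (len y')) => //; rewrite ?alt_letterS //; last by rewrite -Ey.
    by rewrite -ny ly.
  by rewrite ly0 ly addnS.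
move: H; rewrite aSS.
have -> : rp y f = act q (rp y' f) by rewrite Ey rpM rp_gen.
rewrite act_eq act_neq 1?eq_sym // (msym q p) mpq; congr (_ < _)%R; ring.
Qed.

(** Some generator t different from s lowers y; the element y is then divided
    by the longest possible element of the dihedral group of s and t. *)
Lemma rep_positivity y (s : S) f : (len y < len (val s * y))%N ->
  (forall t, 0 < f (Some t))%R -> (0 < rp y f (Some s))%R.
Proof.
move=> + f_gt0; have [n] := ubnP (len y).
elim: n y s => // n IH y s yn sy.
have [y1|/eqP/(left_descent coxS)[t ty]] := eqVneq y 1.
  by rewrite y1 rp1.
have st : s != t by apply: contraTneq sy => ->; rewrite -leqNgt ltnW.
have [[a0 a1] _ _ _] := ca (mneq1 st).
have := @dihedral_descent s t y f st sy ty _ (len y) 0 y s t.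
rewrite a0 a1 mul0r addr0 mul1r; apply=> //.
- by move=> y' u ly' uy'; apply: IH => //; apply: leq_trans ly' _.
- by rewrite /= mul1g.
- by have := mneq1 st; lia.
Qed.

End Positivity.

Lemma geometric_rep_from_chebyshev : inhabited (geometric_rep R S).
Proof.
have [rp [rp1 rpM rp_gen]] := coxeter_action mP act_invol act_braid.
have genE s f u : (rp (val s) f u = f u - f (Some s) * cr s u)%R.
  by rewrite rp_gen.
exists; exact: (GeometricRep cr_diag (fun => erefl) rp1 rpM genE
  (rep_positivity rp1 rpM rp_gen)).
Qed.

End Construction.

Lemma geometric_rep_exists (R : realType) (W : groupType) (S : set W) :
  coxeter_system S -> inhabited (geometric_rep R S).
Proof.
move=> [m [mM mP]].
have /choice[ca caP] : forall n, exists ca : R * (nat -> R),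
    n != 1%N -> chebyshev_data n ca.1 ca.2.
  move=> n; have [->|n1] := eqVneq n 1%N; first by exists (0%R, fun=> 0%R).
  by have [c [a ca]] := chebyshev_exists R n1; exists (c, a).
exact: (@geometric_rep_from_chebyshev R W S m mM mP
  (fun n => (ca n).1) (fun n => (ca n).2) caP).
Qed.

Local Open Scope classical_set_scope.

(** * Roots and the strong exchange property *)
Section ReflectionOrder.

Variables (R : realType) (W : groupType) (S : set W).
Hypothesis coxS : coxeter_system S.
Variable G : geometric_rep R S.

Local Notation len := (cox_length S).
Local Notation refl := (reflections S).
Local Notation rep := (rep_act G).
Local Notation coroot := (coroot_of G).
Local Notation "p <=B q" := (bruhat S p q) (at level 70).
Implicit Types (f : option S -> R) (s u : S) (g h w y t p q z : W).

(** The root g^-1 (alpha_s), as a linear form. A root is given by a pair (g, s)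
    throughout; distinct pairs may give the same root. *)
Definition root_form g s f : R := rep g f (Some s).

Definition root_refl g s : W := val s ^ g.

Definition chamber : set (option S -> R) :=
  [set f | forall s, 0 < f (Some s)]%R.

Definition closed_chamber : set (option S -> R) :=
  [set f | forall s, 0 <= f (Some s)]%R.

Definition center : option S -> R := fun=> 1%R.

Lemma chamber_center : chamber center.
Proof. by move=> s; rewrite ltr01. Qed.

Lemma coxeter_ind (P : W -> Prop) :
  P 1 -> (forall s w, P w -> P (val s * w)) -> forall w, P w.
Proof.
move=> P1 PM w; have [u <-] := word_exists coxS w.
by elim: u => [|s u IH]; rewrite ?big_nil // big_cons; exact: PM.
Qed.

Lemma rep_linear w (k : R) f1 f2 :
  rep w (fun v => k * f1 v + f2 v)%R = (fun v => k * rep w f1 v + rep w f2 v)%R.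
Proof.
elim/coxeter_ind: w => [|s w IH]; first by rewrite !rep1.
by apply/funext => v; rewrite !repM !rep_gen IH; ring.
Qed.

Lemma repK w f : rep w (rep w^-1 f) = f.
Proof. by rewrite -repM mulgV rep1. Qed.

Lemma repVK w f : rep w^-1 (rep w f) = f.
Proof. by rewrite -repM mulVg rep1. Qed.

Lemma root_linear g s (k : R) f1 f2 :
  root_form g s (fun v => k * f1 v + f2 v)%R =
  (k * root_form g s f1 + root_form g s f2)%R.
Proof. by rewrite /root_form rep_linear. Qed.

Lemma root_rep g h s f : root_form g s (rep h f) = root_form (g * h) s f.
Proof. by rewrite /root_form repM. Qed.

Lemma root_neg g s f : root_form (val s * g) s f = (- root_form g s f)%R.
Proof. by rewrite /root_form repM rep_gen coroot_diag; ring. Qed.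

Lemma root_reflM g h s : root_refl (g * h) s = root_refl g s ^ h.
Proof. exact: conjgM. Qed.

Lemma root_refl_neg g s : root_refl (val s * g) s = root_refl g s.
Proof. by rewrite root_reflM; congr (_ ^ _); rewrite /root_refl conjgE mulKg. Qed.

Definition coroot_vec g s : option S -> R := rep g^-1 (coroot s).

Lemma rep_refl g s f :
  rep (root_refl g s) f =
  (fun v => - root_form g s f * coroot_vec g s v + f v)%R.
Proof.
rewrite /root_refl conjgE !repM.
have -> : rep (val s) (rep g f) =
    (fun v => - root_form g s f * coroot s v + rep g f v)%R.
  by apply/funext => v; rewrite rep_gen /root_form; ring.
by rewrite rep_linear repVK.
Qed.

Lemma root_coroot g s : root_form g s (coroot_vec g s) = 2%R.
Proof. by rewrite /root_form /coroot_vec repK coroot_diag. Qed.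

(** Positive roots are those with s g longer than g. *)
Lemma root_gt0 g s f : chamber f ->
  (0 < root_form g s f)%R = (len g < len (val s * g))%N.
Proof.
move=> f_pos; apply/idP/idP => [|gs]; last exact: rep_gt0.
apply: contraTT => gs.
rewrite -leNgt ltW // -oppr_gt0 -root_neg; apply: rep_gt0 => //.
by rewrite genK //; rewrite -len_genL_ltN // in gs.
Qed.

Lemma root_lt0 g s f : chamber f ->
  (root_form g s f < 0)%R = (len (val s * g) < len g)%N.
Proof.
by move=> f_pos; rewrite -oppr_gt0 -root_neg root_gt0 // genK.
Qed.

Lemma root_neq0 g s f : chamber f -> root_form g s f != 0%R.
Proof.
move=> f_pos; case: (ltnP (len g) (len (val s * g))) => [gs|].
  by rewrite gt_eqF // root_gt0.
by rewrite leqNgt -len_genL_ltN // => gs; rewrite lt_eqF // root_lt0.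
Qed.

(** Perturb a point of the closed chamber by a small multiple of [center]. The
    number e makes a negative value still negative. *)
Lemma root_ge0 g s f : closed_chamber f -> (len g < len (val s * g))%N ->
  (0 <= root_form g s f)%R.
Proof.
move=> f_ge0 gs; rewrite leNgt; apply/negP => rf_lt0.
have c_gt0 : (0 < root_form g s center)%R by rewrite root_gt0 //; exact: chamber_center.
pose e := (- root_form g s f / (2 * root_form g s center))%R.
have e_gt0 : (0 < e)%R by rewrite divr_gt0 ?oppr_gt0 // mulr_gt0.
have : (0 < root_form g s (fun v => e * center v + f v))%R.
  by rewrite root_gt0 // => u; rewrite ltr_wpDr // mulr1.
rewrite root_linear /e; apply/negP; rewrite -leNgt.
have -> : (- root_form g s f / (2 * root_form g s center) * root_form g s center =
  - root_form g s f / 2)%R by field; rewrite gt_eqF.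
by lra.
Qed.

Lemma root_le0 g s f : closed_chamber f -> (len (val s * g) < len g)%N ->
  (root_form g s f <= 0)%R.
Proof.
move=> f_ge0 gs; rewrite -oppr_ge0 -root_neg; apply: root_ge0 => //.
by rewrite genK.
Qed.

Definition indic s : option S -> R := fun v => (v == Some s)%:R%R.

Lemma closed_chamber_indic s : closed_chamber (indic s).
Proof. by move=> u; rewrite /indic ler0n. Qed.

(** If the product z of the two reflections were not 1, some t would lower it,
    so the coordinate t of z f would be nonpositive on the closed chamber. But z
    fixes the hyperplane f u = 0 pointwise and preserves the coordinate u,
    which leaves a point of the closed chamber where it equals 1. *)
Lemma simple_root_refl h s u (k : R) :
  (forall f, root_form h s f = k * f (Some u))%R -> root_refl h s = val u.
Proof.
move=> hk; pose z := root_refl h s * val u.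
pose v' v := (k * coroot_vec h s v - coroot u v)%R.
have zE f v : (rep z f v = f v + f (Some u) * v' v)%R.
  rewrite /z repM rep_refl hk !rep_gen coroot_diag /v'; ring.
suff z1 : z = 1 by rewrite -[LHS](mulg_genK coxS u) -/z z1 mul1g.
apply/eqP; apply/negP => /negP/eqP/(left_descent coxS)[t zt].
have v'u : v' (Some u) = 0%R.
  by have := hk (coroot_vec h s); rewrite root_coroot /v' coroot_diag => <-; ring.
have [tu|tu] := eqVneq t u.
  have := root_lt0 z t chamber_center.
  by rewrite zt /root_form zE tu v'u mulr0 addr0 => /idP; rewrite ltNge ler01.
have := root_le0 (closed_chamber_indic t) zt.
rewrite /root_form zE /indic eqxx.
have -> : (Some u == Some t) = false by apply/eqP => -[ut]; rewrite ut eqxx in tu.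
by rewrite mul0r addr0 leNgt ltr01.
Qed.

Lemma proportional_refl g h s u (k : R) :
  (forall f, root_form h s f = k * root_form g u f)%R ->
  root_refl h s = root_refl g u.
Proof.
move=> hk; have : root_refl (h * g^-1) s = val u.
  apply: (@simple_root_refl _ _ _ k) => f.
  by rewrite -root_rep hk /root_form repK.
by move=> E; rewrite -[LHS](conjgKV g) -root_reflM E.
Qed.

Lemma refl_proportional g h s u : root_refl h s = root_refl g u ->
  exists2 k : R, k != 0%R & forall f, root_form h s f = (k * root_form g u f)%R.
Proof.
move=> E; pose k := (root_form h s (coroot_vec g u) / 2)%R.
have kE f : root_form h s f = (k * root_form g u f)%R.
  have := congr1 (fun t => root_form h s (rep t f)) E; rewrite /= !rep_refl.
  by rewrite !root_linear root_coroot /k; lra.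
exists k => //; apply: contra_neq (root_neq0 h s chamber_center) => k0.
by rewrite kE k0 mul0r.
Qed.

(** The root (h, s) is nonnegative on the closed chamber C and nonpositive on
    u C, hence vanishes on the common wall f u = 0, so it is a multiple of the
    simple root u. *)
Lemma simple_exchange h s u : (len h < len (val s * h))%N ->
  (len (val s * (h * val u)) < len (h * val u))%N -> root_refl h s = val u.
Proof.
move=> sh shu.
have face f : closed_chamber f -> f (Some u) = 0%R -> root_form h s f = 0%R.
  move=> f_ge0 fu; apply/eqP; rewrite eq_le (root_ge0 f_ge0 sh) andbT.
  have := root_le0 f_ge0 shu; rewrite -root_rep.
  have -> // : rep (val u) f = f.
  by apply/funext => v; rewrite rep_gen fu mul0r subr0.
have wall f : f (Some u) = 0%R -> root_form h s f = 0%R.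
  move=> fu; pose f1 v := Num.max (f v) 0%R; pose f2 v := Num.max (- f v)%R 0%R.
  have -> : f = (fun v => -1 * f2 v + f1 v)%R.
    by apply/funext => v; rewrite /f1 /f2 /Num.max; do 2 case: ltP => ?; lra.
  rewrite root_linear !face ?mulr0 ?addr0 // /f1 /f2 ?fu ?oppr0 ?maxxx //.
    by move=> v; rewrite le_max lexx orbT.
  by move=> v; rewrite le_max lexx orbT.
apply: (@simple_root_refl _ _ _ (root_form h s (indic u))) => f.
have E : f = (fun v => f (Some u) * indic u v + (f v - f (Some u) * indic u v))%R.
  by apply/funext => v; ring.
rewrite [in LHS]E root_linear [X in (_ + X)%R]wall; last by rewrite /indic eqxx mulr1 subrr.
by rewrite addr0 mulrC.
Qed.

(** The hyperplane of the root separates C from y^-1 C, so it is crossed at some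
    letter of a reduced word of y. At the crossing it is the wall of that letter
    by [simple_exchange], and multiplying by the reflection deletes the
    letter. *)
Lemma strong_exchange_lt g s y : (len g < len (val s * g))%N ->
  (root_form g s (rep y^-1 center) < 0)%R ->
  (len (y * root_refl g s) < len y)%N.
Proof.
rewrite -(root_gt0 _ _ chamber_center).
have [n] := ubnP (len y); elim: n g y => // n IH g y yn g_gt0 gy_lt0.
have [y1|/eqP] := eqVneq y^-1 1; first by move: gy_lt0; rewrite y1 rep1 ltNge ltW.
move=> /(left_descent coxS)[u]; set z := val u * y^-1 => uy.
have Ey : y = z^-1 * val u by rewrite invgM invgK gen_inv // mulg_genK.
have ly : len y = (len z^-1).+1.
  by rewrite -(len_inv coxS y) (len_genL_gt coxS uy) len_inv.
pose g' := g * val u.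
have g'y : root_form g' s (rep z^-1^-1 center) = root_form g s (rep y^-1 center).
  by rewrite !root_rep invgK /g' /z -mulgA genK.
have Et : root_refl g s = val u * root_refl g' s * val u.
  rewrite /g' root_reflM; move: (root_refl g s) => t.
  by rewrite conjgE gen_inv // !mulgA gen_invol // mul1g mulg_genK.
have Eyt : y * root_refl g s = z^-1 * root_refl g' s * val u.
  rewrite Et {1}Ey; move: (root_refl g' s) => t'.
  by rewrite !mulgA mulg_genK.
have [g'_gt0|g'_le0] := ltP 0%R (root_form g' s center).
  rewrite Eyt ly ltnS; apply: leq_trans (len_mul coxS _ _) _.
  by rewrite len_gen // addn1; apply: IH => //; rewrite ?g'y //; lia.
have gu : root_refl g s = val u.
  apply: simple_exchange; first by rewrite -(root_gt0 _ _ chamber_center).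
  rewrite -(root_lt0 _ _ chamber_center) lt_neqAle g'_le0 andbT.
  by rewrite root_neq0 //; exact: chamber_center.
by rewrite gu {1}Ey mulg_genK // ly.
Qed.

(** When the root is positive on y^-1 C, it is negative on (y t)^-1 C for the
    reflection t of the root, so [strong_exchange_lt] applies to y t. *)
Lemma strong_exchange g s y : (len g < len (val s * g))%N ->
  (len y < len (y * root_refl g s))%N = (0 < root_form g s (rep y^-1 center))%R.
Proof.
move=> gs; apply/idP/idP => [y_lt|gy_gt0].
  rewrite ltNge le_eqVlt negb_or root_rep root_neq0 /=; last exact: chamber_center.
  apply: contraTN y_lt; rewrite -root_rep -leqNgt => gy_lt0.
  by rewrite ltnW // strong_exchange_lt.
have tt : root_refl g s * root_refl g s = 1.
  by rewrite /root_refl -conjMg gen_invol // conj1g.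
have tV : (root_refl g s)^-1 = root_refl g s by exact: mulg1_eq.
rewrite -{1}[y](mulgK (root_refl g s)) tV; apply: strong_exchange_lt => //.
rewrite invgM tV repM rep_refl.
by rewrite root_linear root_coroot; lra.
Qed.

(** The hyperplane of the reflection separates y^-1 C from (u y)^-1 C, and
    these two chambers share only one wall. *)
Lemma refl_step_flip g s y u : (len g < len (val s * g))%N ->
  (len y < len (y * root_refl g s))%N ->
  (len (val u * (y * root_refl g s)) < len (val u * y))%N ->
  val u * y = y * root_refl g s.
Proof.
move=> gs yt; rewrite ltnNge leq_eqVlt negb_or mulgA => /andP[_].
move: yt; rewrite !strong_exchange // root_rep => gy_gt0.
rewrite invgM gen_inv // !root_rep -leNgt => gyu_le0.
have : root_refl (g * y^-1) s = val u.
  apply: simple_exchange; first by rewrite -(root_gt0 _ _ chamber_center).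
  rewrite -(root_lt0 _ _ chamber_center) lt_neqAle.
  by rewrite -mulgA gyu_le0 andbT root_neq0 //; exact: chamber_center.
by rewrite root_reflM => <-; move: (root_refl g s) => t; rewrite conjgE invgK mulgA mulgVK.
Qed.

(** Each letter s of a reduced word of w subtracts the value of a positive root
    at [center]. *)
Lemma height_lt w : w <> 1 -> (rep w center None < 1)%R.
Proof.
have le1 : forall n w, (len w <= n)%N ->
    (rep w center None <= 1)%R /\ (w <> 1%g -> rep w center None < 1)%R.
  elim=> [|n IH] {}w; first by rewrite leqn0 => /eqP/(len_eq0 coxS)->; rewrite rep1.
  have [-> _|/eqP w1 wn] := eqVneq w 1; first by rewrite rep1.
  have [s sw] := left_descent coxS w1.
  have lw := len_genL_gt coxS sw.
  suff lt1 : (rep w center None < 1)%R by split=> //; exact: ltW.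
  rewrite -{1}(genK coxS s w) repM rep_gen coroot_height mulr1.
  have [|le1 _] := IH (val s * w); first by lia.
  have : (0 < root_form (val s * w) s center)%R.
    by rewrite root_gt0 ?genK //; exact: chamber_center.
  by rewrite /root_form; lra.
by move=> w1; case: (le1 (len w) w) => // _; apply.
Qed.

(** The reflection t moves [center] by a negative multiple of this coroot, and
    by [height_lt] it lowers the height. *)
Lemma coroot_vec_height_gt0 g s : (len g < len (val s * g))%N ->
  (0 < coroot_vec g s None)%R.
Proof.
rewrite -(root_gt0 _ _ chamber_center) => g_gt0.
have : (rep (root_refl g s) center None < 1)%R.
  apply: height_lt => t1; have := root_coroot g s.
  have := congr1 (fun t => root_form g s (rep t (coroot_vec g s))) t1.
  by rewrite /= rep_refl rep1 root_linear => E r2; move: E; rewrite r2; lra.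
by rewrite rep_refl {2}/center gtrDr mulNr oppr_lt0 pmulr_rgt0.
Qed.

(** Along an edge going up by the reflection of the root, the height of the
    image of a point moves against the sign of the root at that point. *)
Lemma height_step g s y : (len g < len (val s * g))%N ->
  (len y < len (y * root_refl g s))%N ->
  exists2 k : R, (0 < k)%R & forall f,
    rep (y * root_refl g s) f None = (rep y f None - root_form g s f * k)%R.
Proof.
move=> gs; rewrite strong_exchange // root_rep (root_gt0 _ _ chamber_center).
move=> /coroot_vec_height_gt0 k_gt0; exists (coroot_vec (g * y^-1) s None) => // f.
by rewrite repM rep_refl rep_linear /coroot_vec -repM invgM invgK; ring.
Qed.

(** * The reflection order by slopes *)
Lemma reflP t : refl t ->
  exists g s, t = root_refl g s /\ (len g < len (val s * g))%N.
Proof.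
move=> [s0 /mem_set Ss0 [g _ <-]]; pose s : S := exist _ s0 Ss0.
have [gs|] := ltnP (len g) (len (val s * g)); first by exists g, s.
rewrite leqNgt -len_genL_ltN // => gs; exists (val s * g), s.
by rewrite root_refl_neg genK.
Qed.

Lemma refl_root g s : refl (root_refl g s).
Proof. by exists (val s); [exact/set_mem/valP|exists g]. Qed.

Lemma refl_invol t : refl t -> t * t = 1.
Proof.
move=> /reflP[g [s [-> _]]].
by rewrite /root_refl -conjMg gen_invol // conj1g.
Qed.

Lemma mulg_reflK t : refl t -> forall y, y * t * t = y.
Proof. by move=> tt y; rewrite -mulgA refl_invol // mulg1. Qed.

Lemma odd_len_refl t : refl t -> odd (len t).
Proof.
move=> /reflP[g [s [-> _]]]; rewrite /root_refl conjgE !odd_len_mul //.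
by rewrite len_inv // len_gen // addTb addbN addbb.
Qed.

Lemma len_refl t y : refl t ->
  (len (y * t) < len y)%N = ~~ (len y < len (y * t))%N.
Proof. by move=> /odd_len_refl; have := odd_len_mul coxS y t; lia. Qed.

(** The two roots of a reflection have the same slope, as the quotient does not
    change under scaling; the value 0 off the reflections is arbitrary. *)
Definition slope_at f t : R := xget 0%R
  [set r | exists g s,
     t = root_refl g s /\ r = root_form g s f / root_form g s center]%R.

Lemma slopeE f g s :
  slope_at f (root_refl g s) = (root_form g s f / root_form g s center)%R.
Proof.
rewrite /slope_at; case: xgetP => [r _ [h [u [E ->]]]|]; last first.
  by move=> /(_ (root_form g s f / root_form g s center)%R); case; exists g, s.
have [k k0 kE] := refl_proportional (esym E).
rewrite !kE; field; rewrite k0 /= root_neq0 //; exact: chamber_center.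
Qed.

Lemma slope_linear t (k : R) f1 f2 : refl t ->
  slope_at (fun v => k * f1 v + f2 v)%R t =
  (k * slope_at f1 t + slope_at f2 t)%R.
Proof.
move=> /reflP[g [s [-> _]]]; rewrite !slopeE root_linear //; field.
by rewrite root_neq0 //; exact: chamber_center.
Qed.

(** The root (y t, s) differs from (y, s) by a multiple of the root of t, so both
    have the same determinant with the root of t at the points f and [center];
    the equation is this equality after division. *)
Lemma slope_transport f y s t : refl t ->
  ((slope_at f (root_refl (y * t) s) - slope_at f t) * root_form (y * t) s center =
   (slope_at f (root_refl y s) - slope_at f t) * root_form y s center)%R.
Proof.
move=> /reflP[g [u [-> gu]]].
have root_yt f' : root_form (y * root_refl g u) s f' =
    (root_form y s f' - root_form y s (coroot_vec g u) * root_form g u f')%R.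
  by rewrite -root_rep rep_refl root_linear; ring.
have c0 := root_neq0 _ _ chamber_center.
have := c0 (y * root_refl g u) s; have := c0 y s; have := c0 g u.
rewrite !slopeE !root_yt => gu0 ys0 ytu0.
by field; rewrite gu0 ys0.
Qed.

Lemma slope_same_side f y s t : refl t ->
  (len y < len (val s * y))%N = (len (y * t) < len (val s * (y * t)))%N ->
  (slope_at f (root_refl (y * t) s) < slope_at f t)%R =
  (slope_at f (root_refl y s) < slope_at f t)%R.
Proof.
move=> tt; rewrite -!(root_gt0 _ _ chamber_center) => side.
have := slope_transport f y s tt; move: side.
have c0 := root_neq0 _ _ chamber_center.
case: (ltP 0%R (root_form y s center)) => y_side /esym.
  by move=> yt_side E; rewrite -subr_lt0 -(pmulr_llt0 _ yt_side) E pmulr_llt0 // subr_lt0.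
move/negbT; rewrite -leNgt => yt_side E.
have {}y_side : (root_form y s center < 0)%R by rewrite lt_neqAle c0.
have {}yt_side : (root_form (y * t) s center < 0)%R by rewrite lt_neqAle c0.
by rewrite -subr_lt0 -(nmulr_lgt0 _ yt_side) E nmulr_lgt0 // subr_lt0.
Qed.

Lemma slope_other_side f y s t : refl t ->
  (len y < len (val s * y))%N = ~~ (len (y * t) < len (val s * (y * t)))%N ->
  (slope_at f (root_refl (y * t) s) < slope_at f t)%R =
  (slope_at f t < slope_at f (root_refl y s))%R.
Proof.
move=> tt; rewrite -!(root_gt0 _ _ chamber_center) => side.
have := slope_transport f y s tt; move: side.
have c0 := root_neq0 _ _ chamber_center.
case: (ltP 0%R (root_form y s center)) => y_side /esym.
  move=> /negbTE/negbT; rewrite -leNgt => yt_side E.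
  have {}yt_side : (root_form (y * t) s center < 0)%R by rewrite lt_neqAle c0.
  by rewrite -subr_lt0 -(nmulr_lgt0 _ yt_side) E pmulr_lgt0 // subr_gt0.
move/negbFE => yt_side E.
have {}y_side : (root_form y s center < 0)%R by rewrite lt_neqAle c0.
by rewrite -subr_lt0 -(pmulr_llt0 _ yt_side) E nmulr_llt0 // subr_gt0.
Qed.

(** The vector f - tau center takes at a root the sign of slope minus tau, so the
    height moves down exactly along steps whose slope exceeds tau. *)
Lemma slope_height f y t : refl t -> (len y < len (y * t))%N ->
  exists2 k : R, (0 < k)%R & forall tau : R,
    let p := fun v => (- tau * center v + f v)%R in
    (rep (y * t) p None = rep y p None - (slope_at f t - tau) * k)%R.
Proof.
move=> /reflP[g [s [-> gs]]] yt.
have [k k0 kE] := height_step gs yt.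
have g0 : (0 < root_form g s center)%R by rewrite root_gt0 //; exact: chamber_center.
exists (root_form g s center * k)%R; first by rewrite mulr_gt0.
move=> tau p; rewrite kE /p root_linear // slopeE; field.
by rewrite gt_eqF.
Qed.

(** Take the slope of p as threshold. By [slope_height] the height would increase
    from y to the top along r, r', and weakly decrease along p, p'. *)
Lemma rank2_slopes f y r r' p p' : refl r -> refl r' -> refl p -> refl p' ->
  (len y < len (y * r))%N -> (len (y * r) < len (y * r * r'))%N ->
  (len y < len (y * p))%N -> (len (y * p) < len (y * p * p'))%N ->
  y * r * r' = y * p * p' ->
  (slope_at f r < slope_at f p)%R -> (slope_at f r' < slope_at f p)%R ->
  (slope_at f p < slope_at f p')%R -> False.
Proof.
move=> rr rr' pp pp' yr yrr' yp ypp' E rp r'p pp1.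
have [k1 k1_gt0 E1] := slope_height f rr yr.
have [k2 k2_gt0 E2] := slope_height f rr' yrr'.
have [k3 k3_gt0 E3] := slope_height f pp yp.
have [k4 k4_gt0 E4] := slope_height f pp' ypp'.
have := E2 (slope_at f p); rewrite /= (E1 (slope_at f p)) E (E4 (slope_at f p)).
rewrite (E3 (slope_at f p)) subrr mul0r subr0.
have p1 : (0 < (slope_at f p - slope_at f r) * k1)%R by rewrite mulr_gt0 ?subr_gt0.
have p2 : (0 < (slope_at f p - slope_at f r') * k2)%R by rewrite mulr_gt0 ?subr_gt0.
have p4 : (0 < (slope_at f p' - slope_at f p) * k4)%R by rewrite mulr_gt0 ?subr_gt0.
lra.
Qed.

(** A finite union of proper hyperplanes does not cover the open chamber: moving
    from a point good for the previous forms by e in a direction good for the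
    new one, only finitely many values of e are bad. *)
Lemma generic_point (J : eqType) (A : J -> (option S -> R) -> R) (l : seq J) :
  {in l, forall j (k : R) f1 f2,
    A j (fun v => k * f1 v + f2 v)%R = (k * A j f1 + A j f2)%R} ->
  {in l, forall j, exists2 f, chamber f & A j f != 0%R} ->
  exists2 f, chamber f & {in l, forall j, A j f != 0%R}.
Proof.
elim: l => [|j l IH] A_lin l_neq0; first by exists center.
have sub i : i \in l -> i \in j :: l by move=> il; rewrite inE il orbT.
have [i il|i il|f fC fl] := IH.
- exact: A_lin (sub i il).
- exact: l_neq0 (sub i il).
have jl : j \in j :: l by rewrite mem_head.
have [v vC vj] := l_neq0 j jl.
have [fj|fj] := eqVneq (A j f) 0%R; last first.
  by exists f => // i; rewrite inE => /predU1P[->//|]; exact: fl.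
(* A positive number larger than every bad value. *)
pose e := (1 + \sum_(x <- [seq (- A i f / A i v) | i <- l]) `|x|)%R.
have e_gt0 : (0 < e)%R by rewrite ltr_pwDl // sumr_ge0.
exists (fun x => e * v x + f x)%R => [s|i].
  by rewrite addr_gt0 // mulr_gt0.
rewrite inE => /predU1P[->|il].
  by rewrite A_lin // fj addr0 mulf_neq0 // gt_eqF.
rewrite A_lin ?sub //; apply/eqP => Ai0; have fi := fl i il.
have vi : A i v != 0%R.
  by apply: contra_neq fi => vi; move: Ai0; rewrite vi mulr0 add0r.
have eE : e = (- A i f / A i v)%R.
  by apply: (mulIf vi); rewrite divfK //; lra.
have : (`|e| <= \sum_(x <- [seq (- A i f / A i v) | i <- l]) `|x|)%R.
  by rewrite eE big_map (big_rem i) //= lerDl sumr_ge0.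
by rewrite gtr0_norm // leNgt /e ltrDr ltr01.
Qed.

Lemma chamber_span f : exists f1 f2, [/\ chamber f1, chamber f2 &
  f = (fun v => -1 * f2 v + f1 v)%R].
Proof.
exists (fun v => Num.max (f v) 0 + 1)%R, (fun v => Num.max (- f v) 0 + 1)%R.
split=> [s|s|]; try by rewrite ltr_wpDl // le_max lexx orbT.
by apply/funext => v; rewrite /Num.max; do 2 case: ltP => ?; lra.
Qed.

(** The slope is measured at a generic point of the chamber y^-1 C. A root which
    is positive on C is negative there exactly if its hyperplane separates C
    from y^-1 C, that is, if the reflection lowers y. Genericity makes slopes
    of different reflections different, since proportional roots belong to the
    same reflection. *)
Lemma generic_slope y (L : seq W) : {in L, forall t, refl t} ->
  exists f, (forall t, refl t -> (slope_at f t < 0)%R = (len (y * t) < len y)%N) /\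
    {in L &, injective (slope_at f)}.
Proof.
move=> L_refl.
pose A (tt : W * W) f := (slope_at (rep y^-1 f) tt.1 - slope_at (rep y^-1 f) tt.2)%R.
pose l := [seq tt <- [seq (t1, t2) | t1 <- L, t2 <- L] | tt.1 != tt.2].
have lP tt : tt \in l -> [/\ refl tt.1, refl tt.2 & tt.1 != tt.2].
  rewrite mem_filter => /andP[neq /allpairsP[[a b] [/= aL bL E]]].
  by move: neq; rewrite E /= => ab; split=> //; exact: L_refl.
have A_lin tt (k : R) f1 f2 : tt \in l ->
    A tt (fun v => k * f1 v + f2 v)%R = (k * A tt f1 + A tt f2)%R.
  by move=> /lP[r1 r2 _]; rewrite /A rep_linear // !slope_linear //; ring.
have [||f0 f0C f0l] := @generic_point _ A l.
- by move=> tt ttl k f1 f2; exact: A_lin.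
- move=> tt ttl; have [r1 r2 /eqP tt_neq] := lP _ ttl.
  apply: contrapT => A0; apply: tt_neq.
  have {}A0 f : chamber f -> A tt f = 0%R.
    by move=> fC; apply: contrapT => /eqP Af; apply: A0; exists f.
  have slopes_eq f : slope_at f tt.1 = slope_at f tt.2.
    have [f1 [f2 [f1C f2C E]]] := chamber_span (rep y f).
    have : A tt (rep y f) = 0%R by rewrite E A_lin // !A0 // mulr0 addr0.
    by rewrite /A repVK // => /eqP; rewrite subr_eq0 => /eqP.
  have [g [s [E1 _]]] := reflP r1; have [h [u [E2 _]]] := reflP r2.
  rewrite E1 E2 in slopes_eq *.
  apply: (@proportional_refl h g s u
    (root_form g s center / root_form h u center)) => f.
  have g0 := root_neq0 g s chamber_center.
  have := slopes_eq f; rewrite !slopeE => /(congr1 (fun x => x * root_form g s center)%R).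
  by rewrite divfK // => ->; ring.
exists (rep y^-1 f0); split=> [t|t1 t2 t1L t2L t12].
  move=> /reflP[g [s [-> gs]]]; rewrite slopeE.
  have c0 : (0 < root_form g s center)%R by rewrite root_gt0 //; exact: chamber_center.
  rewrite pmulr_llt0 ?invr_gt0 // root_rep root_lt0 // len_refl; last exact: refl_root.
  rewrite (strong_exchange) // root_rep.
  by rewrite (root_gt0 _ _ chamber_center) len_genL_ltN.
apply/eqP/negP => /negP neq; have : (t1, t2) \in l.
  by rewrite mem_filter neq; apply/allpairsP; exists (t1, t2).
by move=> /f0l; rewrite /A /= t12 subrr eqxx.
Qed.

(** * The lifting property of the Bruhat order *)
Implicit Types v : W.

Lemma bruhat_refl p : p <=B p.
Proof. exact: rt_refl. Qed.

Lemma bruhat_trans q p v : p <=B q -> q <=B v -> p <=B v.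
Proof. exact: rt_trans. Qed.

Lemma bruhat_up t y : refl t -> (len y < len (y * t))%N -> y <=B y * t.
Proof. by move=> tt yt; apply: rt_step; exists t. Qed.

Lemma bruhat_len p q : p <=B q -> p = q \/ (len p < len q)%N.
Proof.
elim=> [x y [t _ [-> lt]]|x|x y z _ IH1 _ IH2]; [by right|by left|].
case: IH1 => [->|xy] //; case: IH2 => [<-|yz]; right => //.
exact: ltn_trans yz.
Qed.

Lemma bruhat_le_len p q : p <=B q -> (len p <= len q)%N.
Proof. by case/bruhat_len=> [->|/ltnW]. Qed.

Lemma bruhat_anti p q : p <=B q -> q <=B p -> p = q.
Proof. by move=> /bruhat_len[//|lt] /bruhat_le_len; rewrite leqNgt lt. Qed.

Lemma bruhat_gen_up s y : (len y < len (val s * y))%N -> y <=B val s * y.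
Proof.
move=> sy; rewrite conjgC; apply: bruhat_up; last by rewrite -conjgC.
exact: refl_root.
Qed.

Lemma bruhat_gen_down s y : (len (val s * y) < len y)%N -> val s * y <=B y.
Proof. by move=> sy; rewrite -{2}(genK coxS s y); apply: bruhat_gen_up; rewrite genK. Qed.

(** Multiplying a step by s on the left preserves its direction, except when
    the step is the edge from y to s y itself, by [refl_step_flip]. *)
Lemma bruhat_step_gen s y z : bruhat_step S y z ->
  val s * y = z \/ bruhat_step S (val s * y) (val s * z).
Proof.
move=> [t tt [-> yt]].
have [syt|] := ltnP (len (val s * y)) (len (val s * (y * t))).
  by right; exists t; rewrite // mulgA in syt *.
rewrite leq_eqVlt => /orP[/eqP E|syt]; last first.
  left; have [g [u [Et gu]]] := reflP tt; rewrite Et in yt syt *.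
  exact: (refl_step_flip).
have := odd_len_mul coxS (val s * y) t.
by rewrite -mulgA E (odd_len_refl tt) addbT; case: (odd _).
Qed.

(** Chain the steps of [bruhat_step_gen]. A reversed edge in the middle replaces
    the first alternative by the second, and a further one changes back. *)
Lemma bruhat_gen s p q : p <=B q ->
  val s * p <=B val s * q \/ (val s * p <=B q /\ p <=B val s * q).
Proof.
have sK := genK coxS s.
elim=> [x y xy|x|x y z xy IH1 yz IH2]; last 1 first.
- case: IH1 IH2 => [le1|[le1 le2]] [le3|[le3 le4]].
  + by left; exact: bruhat_trans le3.
  + by right; split; [exact: bruhat_trans le3|exact: bruhat_trans xy le4].
  + by right; split; [exact: bruhat_trans yz|exact: bruhat_trans le3].
  + by left; exact: bruhat_trans le4.
- have [E|st] := bruhat_step_gen s xy; last by left; exact: rt_step.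
  by right; rewrite -E sK; split; exact: bruhat_refl.
- by left; exact: bruhat_refl.
Qed.

Lemma lift_gen s p q : p <=B q -> (len (val s * q) < len q)%N ->
  val s * p <=B q.
Proof.
move=> pq sq; have [le|[]//] := bruhat_gen s pq.
exact: bruhat_trans (bruhat_gen_down sq).
Qed.

Lemma lift_up s p q : p <=B q -> (len p < len (val s * p))%N -> p <=B val s * q.
Proof.
move=> pq sp; have [le|[]//] := bruhat_gen s pq.
exact: bruhat_trans (bruhat_gen_up sp) le.
Qed.

Lemma lift_both s p q : p <=B q -> (len (val s * p) < len p)%N ->
  val s * p <=B val s * q.
Proof.
move=> pq sp; have [//|[_ le]] := bruhat_gen s pq.
exact: bruhat_trans (bruhat_gen_down sp) le.
Qed.

Lemma bruhat1 p : p <=B 1 -> p = 1.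
Proof. by move=> /bruhat_len[//|]; rewrite len1. Qed.

Lemma lower_interval_gen s w v : (len (val s * w) < len w)%N ->
  v <=B w <-> (v <=B val s * w \/ val s * v <=B val s * w).
Proof.
move=> sw; split=> [vw|[le|le]].
- have [sv|] := ltnP (len v) (len (val s * v)); first by left; exact: lift_up.
  by rewrite leqNgt -len_genL_ltN // => sv; right; exact: lift_both.
- exact: bruhat_trans (bruhat_gen_down sw).
- rewrite -(genK coxS s v); apply: lift_gen => //.
  exact: bruhat_trans (bruhat_gen_down sw).
Qed.

Lemma coxeter_len_ind (P : W -> Prop) : P 1 ->
  (forall s w, (len (val s * w) < len w)%N -> P (val s * w) -> P w) ->
  forall w, P w.
Proof.
move=> P1 PS w; have [n] := ubnP (len w); elim: n w => // n IH w wn.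
have [->//|/eqP/(left_descent coxS)[s sw]] := eqVneq w 1.
by apply: (PS s) => //; apply: IH; lia.
Qed.

Lemma lower_interval_finite w : exists K : seq W, forall v, v <=B w -> v \in K.
Proof.
elim/coxeter_len_ind: w => [|s w sw [K KP]].
  by exists [:: 1] => v /bruhat1 ->; rewrite mem_head.
exists (K ++ [seq val s * v | v <- K]) => v /(lower_interval_gen _ sw)[] /KP vK.
  by rewrite mem_cat vK.
rewrite mem_cat; apply/orP; right; apply/mapP; exists (val s * v) => //.
by rewrite genK.
Qed.

(** For s w < w the shifted interval Q is the union of P and s P, with P that of
    s w. The smaller of b and s b is the minimum of Q when b is that of P, by
    lifting, and the larger of c and s c is the maximum. *)
Lemma shifted_interval_bounds w y : exists b c,
  is_minimum [set v * y | v in [set v | v <=B w]] (bruhat S) b /\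
  is_maximum [set v * y | v in [set v | v <=B w]] (bruhat S) c.
Proof.
elim/coxeter_len_ind: w => [|s w sw [b [c [[Pb bP] [Pc cP]]]]].
  exists (1 * y), (1 * y).
  by split; (split; first by exists 1 => //; exact: bruhat_refl);
    move=> _ [v /bruhat1 -> <-]; exact: bruhat_refl.
set P := [set v * y | v in [set v | v <=B val s * w]] in Pb bP Pc cP.
set Q := [set v * y | v in [set v | v <=B w]].
have QE z : Q z <-> P z \/ P (val s * z).
  split=> [[v /(lower_interval_gen _ sw)[vw|vw] <-]|].
  - by left; exists v.
  - by right; exists (val s * v) => //; rewrite mulgA.
  move=> [[v vw <-]|[v vw E]].
    by exists v => //; apply/(lower_interval_gen _ sw); left.
  exists (val s * v); last by rewrite -mulgA E genK.
  by apply/(lower_interval_gen _ sw); right; rewrite genK.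
have PQ z : P z -> Q z by move=> Pz; apply/QE; left.
have PsQ z : P z -> Q (val s * z) by move=> Pz; apply/QE; right; rewrite genK.
have [b' [Qb' b'b b'up]] : exists b', [/\ Q b', b' <=B b &
    (len b' < len (val s * b'))%N].
  have [sb|] := ltnP (len b) (len (val s * b)).
    by exists b; split=> //; [exact: PQ|exact: bruhat_refl].
  rewrite leqNgt -len_genL_ltN // => sb; exists (val s * b).
  by rewrite genK //; split=> //; [exact: PsQ|exact: bruhat_gen_down].
have [c' [Qc' cc' c'down]] : exists c', [/\ Q c', c <=B c' &
    (len (val s * c') < len c')%N].
  have [sc|] := ltnP (len c) (len (val s * c)).
    exists (val s * c); rewrite genK //; split=> //; first exact: PsQ.
    exact: bruhat_gen_up.
  rewrite leqNgt -len_genL_ltN // => sc; exists c.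
  by split=> //; [exact: PQ|exact: bruhat_refl].
exists b', c'; split; split=> // z /QE[Pz|Pz].
- exact: bruhat_trans b'b (bP _ Pz).
- rewrite -(genK coxS s z); apply: lift_up => //.
  exact: bruhat_trans b'b (bP _ Pz).
- exact: bruhat_trans (cP _ Pz) cc'.
- rewrite -(genK coxS s z); apply: lift_gen => //.
  exact: bruhat_trans (cP _ Pz) cc'.
Qed.

Section Labels.

Variable f : option S -> R.
Local Notation slope := (slope_at f).
Implicit Types (ts c : seq W).

(** * Counting increasing paths *)
Section IncreasingPaths.

(** The number of ways to climb from p to q by covers while reading [ts] once,
    each entry being used or skipped; when [ts] is strictly sorted by slope,
    these are the increasing chains with labels in [ts]. *)
Fixpoint count_paths ts p q : nat :=
  if ts is t :: ts' then
    (count_paths ts' p q +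
     (if len (p * t) == (len p).+1 then count_paths ts' (p * t) q else 0))%N
  else (p == q) : nat.

Lemma count_paths_cons t ts p q : count_paths (t :: ts) p q =
  (count_paths ts p q +
   (if len (p * t) == (len p).+1 then count_paths ts (p * t) q else 0))%N.
Proof. by []. Qed.

Lemma count_paths_le ts p q : {in ts, forall t, refl t} ->
  count_paths ts p q <> 0%N -> p <=B q.
Proof.
elim: ts p => [|t ts IH] p ts_refl /=.
  by case: eqVneq => // -> _; exact: bruhat_refl.
have ts_refl' : {in ts, forall t, refl t}.
  by move=> x xts; apply: ts_refl; rewrite inE xts orbT.
case: eqP => [pt|_]; last by rewrite addn0; exact: IH.
have [c0|/eqP c0] := eqVneq (count_paths ts p q) 0%N; last by move=> _; exact: IH.
rewrite c0 => /(IH _ ts_refl'); apply: bruhat_trans; apply: bruhat_up.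
  by apply: ts_refl; rewrite mem_head.
by rewrite pt.
Qed.

Let slope_lt t t' := (slope t < slope t')%R.

Let slope_lt_trans : transitive slope_lt.
Proof. by move=> y x z; exact: lt_trans. Qed.

Lemma root_reflE g s : g * root_refl g s = val s * g.
Proof. by rewrite -conjgC. Qed.

Section LeftGenerator.

(** A lower set stable under s; only for its elements is the position of the
    label of the edge to s p relative to the list known. *)
Variables (s : S) (K : W -> Prop).
Hypothesis K_le : forall p q, p <=B q -> K q -> K p.
Hypothesis K_gen : forall p, K p -> K (val s * p).

Let up p := (len p < len (val s * p))%N.

Lemma cover_up p t : refl t -> t <> root_refl p s -> up p ->
  len (p * t) = (len p).+1 -> up (p * t).
Proof.
rewrite /up => tt tp pu pt; have [->//|lt] := len_genL coxS s (p * t).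
case: tp; have [g [v [Et gv]]] := reflP tt; rewrite Et in pt lt *.
apply: (mulgI p); rewrite root_reflE; apply/esym.
by apply: (refl_step_flip) => //; lia.
Qed.

(** Induction on the list of labels still available, with s raising p and z. The
    edge from p to s p has the label m(p); the first statement concerns the
    situation where it is still available, the second the one where it is not.
    Let t be the first label. If t = m(p), the second statement passes to the
    first. Otherwise, a step by t from p has a parallel one from s p, and m(p)
    and m(p t) lie on the same side of t. The only other step is one from s p
    to an element r which s raises; then m(p) and m(r) lie on different sides
    of t, so that the two statements exchange their roles. *)
Lemma count_paths_gen ts : {in ts, forall t, refl t} -> sorted slope_lt ts ->
  (forall p, K p -> root_refl p s \in ts \/
     forall t, t \in ts -> slope_lt (root_refl p s) t) ->
  forall p z, K p -> K z -> up p -> up z ->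
  (root_refl p s \in ts ->
     count_paths ts p z = count_paths ts p (val s * z) /\
     count_paths ts (val s * p) (val s * z) = count_paths ts p (val s * z)) /\
  (root_refl p s \notin ts ->
     count_paths ts p (val s * z) = 0%N /\
     count_paths ts (val s * p) (val s * z) =
       (count_paths ts (val s * p) z + count_paths ts p z)%N).
Proof.
have sK := genK coxS s.
elim: ts => [|t ts IH] ts_refl ts_sorted ts_K p z Kp Kz pu zu.
  split=> // _ /=; split.
    by case: eqP => // E; move: pu; rewrite E /up sK ltnNge ltnW.
  rewrite (inj_eq (mulgI _)).
  by case: (val s * p =P z) => // E; move: zu; rewrite -E /up sK ltnNge ltnW.
have tt : refl t by apply: ts_refl; rewrite mem_head.
have ts_refl' : {in ts, forall x, refl x}.
  by move=> x xts; apply: ts_refl; rewrite inE xts orbT.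
have t_lt x : x \in ts -> slope_lt t x.
  by move: ts_sorted => /= /(order_path_min slope_lt_trans)/allP; apply.
have t_ts : t \notin ts.
  by apply/negP => /t_lt; rewrite /slope_lt ltxx.
have ts_K' q : K q -> root_refl q s \in ts \/
    forall x, x \in ts -> slope_lt (root_refl q s) x.
  move=> /ts_K[|lt]; last by right=> x xts; apply: lt; rewrite inE xts orbT.
  by rewrite inE => /predU1P[->|]; [right|left].
have {}IH := IH ts_refl' (path_sorted ts_sorted) ts_K'.
have [IHin IHnotin] := IH p z Kp Kz pu zu.
(* The edge between p and s p. *)
have [mpt|mpt] := eqVneq (root_refl p s) t.
  split; last by rewrite mpt mem_head.
  move=> _; have [c1 c2] := IHnotin ltac:(by rewrite mpt).
  have ptE : p * t = val s * p by rewrite -mpt root_reflE.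
  have sptE : val s * p * t = p by rewrite -mulgA ptE sK.
  rewrite !count_paths_cons ptE sptE (len_genL_lt coxS pu) eqxx.
  by case: eqP => [|_]; [lia|rewrite c1 c2 add0n addn0 addnC].
have mem_m q : root_refl q s <> t -> K q ->
    (root_refl q s \in ts) = ~~ slope_lt (root_refl q s) t.
  move=> qt Kq; apply/idP/idP => [/t_lt|].
    by rewrite /slope_lt -leNgt; exact: ltW.
  case: (ts_K q Kq); first by rewrite inE => /predU1P[].
  by move=> /(_ t (mem_head _ _)) ->.
have zero q v : ~ K q -> K v -> count_paths ts q v = 0%N.
  move=> Kq Kv; apply/eqP/negP => /negP/eqP/(count_paths_le ts_refl') qv.
  exact: Kq (K_le qv Kv).
have Ksz := K_gen Kz.
have nK q : ~ K (val s * q) -> ~ K q by move=> nKq /K_gen.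
have nK' q : ~ K q -> ~ K (val s * q) by move=> nKq /K_gen; rewrite sK.
rewrite inE (negPf mpt) orFb !count_paths_cons.
have mp_ts := mem_m p (elimN eqP mpt) Kp.
have [ptc|nptc] := eqVneq (len (p * t)) (len p).+1.
  have ptu : up (p * t) by apply: cover_up => //; apply/eqP; rewrite eq_sym.
  have -> : (len (val s * p * t) == (len (val s * p)).+1) = true.
    by rewrite -mulgA (len_genL_lt coxS ptu) (len_genL_lt coxS pu) ptc eqxx.
  (* The parallel steps from p and s p. *)
  have same : slope_lt (root_refl (p * t) s) t = slope_lt (root_refl p s) t.
    by apply: (slope_same_side f tt); move: pu ptu; rewrite /up => -> ->.
  rewrite -(mulgA _ p); have [Kpt|nKpt] := pselect (K (p * t)); last first.
    rewrite (zero _ _ nKpt Kz) (zero _ _ nKpt Ksz).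
    rewrite (zero _ _ (nK' _ nKpt) Kz) (zero _ _ (nK' _ nKpt) Ksz) !addn0.
    by rewrite mp_ts in IHin IHnotin *.
  have mpt' : root_refl (p * t) s <> t.
    move=> E; have := root_reflE (p * t) s.
    rewrite E (mulg_reflK tt) => E'; move/eqP: mpt; apply.
    by apply: (mulgI p); rewrite root_reflE [in LHS]E' sK.
  have [] := IH _ _ Kpt Kz ptu zu; rewrite (mem_m _ mpt' Kpt) same.
  rewrite mp_ts in IHin IHnotin * => IHin' IHnotin'; split=> c.
    by have [[a1 a2] [b1 b2]] := (IHin c, IHin' c); rewrite a1 b1 a2 b2.
  have [[a1 a2] [b1 b2]] := (IHnotin c, IHnotin' c).
  by rewrite a1 b1 a2 b2 addnACA.
rewrite -(mulgA _ p).
have [sptc|nsptc] := eqVneq (len (val s * (p * t))) (len (val s * p)).+1; last first.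
  by rewrite !addn0 mp_ts in IHin IHnotin *.
(* The step from s p to an element raised by s. *)
set r := val s * (p * t).
have [Kr|nKr] := pselect (K r); last first.
  rewrite (zero _ _ nKr Kz) (zero _ _ nKr Ksz) !addn0.
  by rewrite mp_ts in IHin IHnotin *.
have ru : up r.
  rewrite /up ltnNge; apply/negP => rd.
  have := len_genL coxS s r; rewrite /r sK; move: nptc rd sptc; rewrite /r sK.
  by rewrite (len_genL_lt coxS pu); lia.
have other : slope_lt (root_refl r s) t = slope_lt t (root_refl p s).
  rewrite /r mulgA -(root_refl_neg p s).
  apply: (slope_other_side f tt); rewrite -mulgA -/r sK.
  by move: pu ru; rewrite /up => /ltnW; rewrite leqNgt => /negbTE -> ->.
have mrt : root_refl r s <> t.
  move=> E; have := root_reflE r s; rewrite E {1}/r -!mulgA (refl_invol tt) mulg1.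
  rewrite /r sK => E'; move: nptc; rewrite -E' (len_genL_lt coxS pu) eqxx //.
have [] := IH _ _ Kr Kz ru zu; rewrite (mem_m _ mrt Kr) other.
rewrite mp_ts in IHin IHnotin * => IHin' IHnotin'; rewrite !addn0; split=> c.
  have [a1 a2] := IHin c; have [|b1 _] := IHnotin'.
    by rewrite negbK; apply: t_lt; rewrite mp_ts.
  by rewrite a1 a2 b1 addn0.
have [a1 a2] := IHnotin c; have [|b1 _] := IHin'.
  by rewrite /slope_lt -leNgt ltW //; exact/negbNE.
by rewrite a1 a2 b1 addnAC.
Qed.

End LeftGenerator.
End IncreasingPaths.

(** * Saturated chains and their labels *)

Local Notation slope_lt := (fun t t' => slope t < slope t')%R.

Definition bruhat_cover p q : bool :=
  `[< refl (p^-1 * q) >] && (len q == (len p).+1).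

Definition step_refls p c : seq W := pairmap (fun a b => a^-1 * b) p c.

Lemma bruhat_coverP p q : reflect
  (exists t, [/\ refl t, q = p * t & len q = (len p).+1]) (bruhat_cover p q).
Proof.
apply: (iffP andP) => [[/asboolP pq /eqP lq]|[t [tt E lq]]].
  by exists (p^-1 * q); rewrite mulVKg.
by rewrite lq eqxx E mulKg; split=> //; apply/asboolP.
Qed.

Lemma bruhat_cover_le p q : bruhat_cover p q -> p <=B q.
Proof.
by move=> /bruhat_coverP[t [tt -> lq]]; apply: bruhat_up; rewrite ?lq.
Qed.

Lemma chain_le p c : path bruhat_cover p c -> p <=B last p c.
Proof.
elim: c p => [|z c IH] p /=; first by move=> _; exact: bruhat_refl.
by move=> /andP[/bruhat_cover_le pz /IH]; exact: bruhat_trans.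
Qed.

Lemma chain_len p c : path bruhat_cover p c ->
  (len (last p c) = len p + size c)%N.
Proof.
elim: c p => [|z c IH] p /=; first by rewrite addn0.
by move=> /andP[/bruhat_coverP[_ [_ _ lz]] /IH ->]; rewrite lz addnS.
Qed.

Lemma count_paths_chain ts p q : {in ts, forall t, refl t} ->
  count_paths ts p q <> 0%N -> exists c,
  [/\ path bruhat_cover p c, last p c = q & subseq (step_refls p c) ts].
Proof.
elim: ts p => [|t ts IH] p ts_refl; first by rewrite /=; case: eqP => // -> _; exists [::].
have tt : refl t by apply: ts_refl; rewrite mem_head.
have {}IH p' := IH p' (fun x xts => ts_refl x ltac:(by rewrite inE xts orbT)).
rewrite count_paths_cons.
have [c0|/eqP/IH[c [cp cq cts]] _] := eqVneq (count_paths ts p q) 0%N; last first.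
  by exists c; split=> //; exact: subseq_trans (subseq_cons _ _).
rewrite c0; case: eqP => // lt /IH[c [cp cq cts]]; exists (p * t :: c).
split=> //=; last by rewrite mulKg eqxx.
by rewrite cp andbT; apply/bruhat_coverP; exists t.
Qed.

Lemma chain_count_paths ts p c : path bruhat_cover p c ->
  subseq (step_refls p c) ts -> count_paths ts p (last p c) <> 0%N.
Proof.
elim: ts p c => [|t ts IH] p [|z c] //.
- by move=> _ _ /=; rewrite eqxx.
- by move=> _ _; rewrite count_paths_cons; have := IH p [::] isT (sub0seq _) => /=; lia.
rewrite count_paths_cons [path _ _ _]/= [last _ _]/= [step_refls _ _]/=.
move=> /andP[pz zc] /=; case: (p^-1 * z =P t) => [E|_] sub; last first.
  by have := IH p (z :: c); rewrite /= pz zc => /(_ isT sub); lia.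
have [x [_ zx lz]] := bruhat_coverP _ _ pz.
have -> : p * t = z by rewrite -E mulVKg.
by rewrite lz eqxx; have := IH z c zc sub; lia.
Qed.

(** Whether a chain starts with the first label t of the list is determined by
    its labels. Two chains that agree on this are equal by induction; two that
    do not contribute one path each to the two summands of the count. *)
Lemma chain_unique ts p c c' : path bruhat_cover p c -> path bruhat_cover p c' ->
  last p c = last p c' -> (count_paths ts p (last p c) <= 1)%N ->
  subseq (step_refls p c) ts -> subseq (step_refls p c') ts -> c = c'.
Proof.
elim: ts p c c' => [|t ts IH] p c c'.
  by case: c c' => [|z c] [|z' c'].
move=> pc pc' cc' cnt sub sub'; rewrite count_paths_cons in cnt.
have split_chain d : path bruhat_cover p d -> subseq (step_refls p d) (t :: ts) ->
    subseq (step_refls p d) ts \/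
    exists2 e, d = p * t :: e & subseq (step_refls (p * t) e) ts.
  case: d => [|z d]; first by left; exact: sub0seq.
  move=> _ /=; case: (p^-1 * z =P t) => [E sub_d|_ sub_d]; last by left.
  by right; exists d; rewrite -E mulVKg.
have first_step e : path bruhat_cover p (p * t :: e) -> len (p * t) == (len p).+1.
  by move=> /= /andP[/bruhat_coverP[_ [_ _ ->]]].
case: (split_chain c pc sub) => [subc|[e E sube]];
  case: (split_chain c' pc' sub') => [subc'|[e' E' sube']].
- by apply: IH subc subc' => //; apply: leq_trans cnt; exact: leq_addr.
- have := chain_count_paths pc subc; rewrite E' in pc' cc'.
  rewrite (first_step _ pc') in cnt; case/andP: pc' => _ pe'.
  by have := chain_count_paths pe' sube'; move: cnt; rewrite cc' /=; lia.
- have := chain_count_paths pc' subc'; rewrite E in pc cc' cnt.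
  rewrite (first_step _ pc) in cnt; case/andP: pc => _ pe.
  by have := chain_count_paths pe sube; move: cnt; rewrite -cc' /=; lia.
rewrite E E' in pc pc' cc' cnt *; congr (_ :: _).
rewrite (first_step _ pc) in cnt; move: pc pc' => /andP[_ pe] /andP[_ pe'].
by apply: IH sube sube' => //; apply: leq_trans cnt; exact: leq_addl.
Qed.

Section Ordered.

Variables (top : W) (L : seq W).
Hypothesis L_refl : {in L, forall t, refl t}.
Hypothesis L_sorted : sorted slope_lt L.
Hypothesis L_all : forall y z, y <=B top -> z <=B top -> refl (y^-1 * z) ->
  y^-1 * z \in L.

(** Dyer's theorem on increasing chains. For s q < q, [count_paths_gen] with
    z = s q shows that the count for (p, q) equals the one for (p, s q) when s
    raises p, and the one for (s p, s q) otherwise. *)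
Lemma count_paths1 p q : q <=B top -> p <=B q -> count_paths L p q = 1%N.
Proof.
move=> qt pq; elim/(coxeter_len_ind): q p qt pq => [|s q sq IH] p qt pq.
  rewrite (bruhat1 pq).
  have one ts : {in ts, forall t, refl t} -> count_paths ts 1 1 = 1%N.
    elim: ts => [|t ts IHts] ts_refl; first by rewrite /= eqxx.
    have ts_refl' : {in ts, forall x, refl x}.
      by move=> x xts; apply: ts_refl; rewrite inE xts orbT.
    rewrite count_paths_cons IHts //; case: eqP => // lt.
    have [->//|/eqP/(count_paths_le ts_refl')] := eqVneq (count_paths ts (1 * t) 1) 0%N.
    by move=> /bruhat_le_len; rewrite lt len1 // ltn0.
  exact: one.
have sqt : val s * q <=B top by apply: bruhat_trans qt; exact: bruhat_gen_down.
have K_le y z : y <=B z -> z <=B q -> y <=B q by exact: bruhat_trans.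
have K_gen y : y <=B q -> val s * y <=B q by move=> yq; exact: (lift_gen).
have L_in y : y <=B q -> root_refl y s \in L.
  move=> yq; have E : root_refl y s = y^-1 * (val s * y) by rewrite -root_reflE mulKg.
  rewrite E; apply: L_all; try exact: bruhat_trans qt.
    by apply: bruhat_trans qt; exact: K_gen.
  by rewrite -E; exact: refl_root.
have L_K y : y <=B q -> root_refl y s \in L \/
    forall t, t \in L -> (slope (root_refl y s) < slope t)%R.
  by move=> yq; left; exact: L_in.
have qsu : (len (val s * q) < len (val s * (val s * q)))%N by rewrite genK.
have key y yq yu := @count_paths_gen s (fun y => y <=B q) K_le
  K_gen L L_refl L_sorted L_K y (val s * q) yq (bruhat_gen_down sq) yu qsu.
have [spu|] := ltnP (len p) (len (val s * p)).
  have [+ _] := key p pq spu; move=> /(_ (L_in p pq))[E _].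
  by rewrite -(genK coxS s q) -E; apply: IH => //; exact: (lift_up).
rewrite leqNgt -len_genL_ltN // => spd.
have spu : (len (val s * p) < len (val s * (val s * p)))%N by rewrite genK.
have [+ _] := key _ (K_gen _ pq) spu; rewrite !genK // => /(_ (L_in _ (K_gen _ pq)))[E1 E2].
by rewrite E2 -E1; apply: IH => //; exact: (lift_both).
Qed.

Lemma chain_refls_L p c : path bruhat_cover p c -> last p c <=B top ->
  {subset step_refls p c <= L}.
Proof.
elim: c p => [|z c IH] p //= /andP[pz zc] ct x.
rewrite inE => /predU1P[->|]; last exact: IH.
have zt : z <=B top by exact: bruhat_trans (chain_le zc) ct.
apply: L_all => //; first exact: bruhat_trans (bruhat_cover_le pz) zt.
by case/andP: pz => /asboolP.
Qed.

Lemma sorted_subseq_L ts : {subset ts <= L} -> sorted slope_lt ts ->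
  subseq ts L.
Proof.
have trans : transitive slope_lt by move=> y x z; exact: lt_trans.
have irr : irreflexive slope_lt by move=> x; exact: ltxx.
elim: L L_sorted ts => [_ [|t ts] // /(_ t (mem_head _ _))//|t l IH /= l_sorted].
case=> [|t' ts] // sub ts_sorted; rewrite /=.
have t_lt x : x \in l -> slope_lt t x.
  by move: l_sorted => /(order_path_min trans)/allP; apply.
have t'_lt x : x \in ts -> slope_lt t' x.
  by move: ts_sorted => /= /(order_path_min trans)/allP; apply.
have sub_tl x : x \in t' :: ts -> x <> t -> x \in l.
  by move=> /sub; rewrite inE => /predU1P[].
case: eqP => [E|tt'].
  apply: IH; [exact: path_sorted l_sorted| |exact: path_sorted ts_sorted].
  move=> x xts; apply: sub_tl; first by rewrite inE xts orbT.
  by move=> xt; have := t'_lt x xts; rewrite xt E /= ltxx.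
apply: IH => //; first exact: path_sorted l_sorted.
move=> x xts; apply: (sub_tl) => // xt; move: xts; rewrite xt inE.
case/predU1P=> [/esym//|/t'_lt t't].
have := t_lt t' (sub_tl t' (mem_head _ _) tt') => /= tlt'.
by have := lt_trans t't tlt'; rewrite ltxx.
Qed.

Lemma increasing_chain_exists p q : q <=B top -> p <=B q -> exists c,
  [/\ path bruhat_cover p c, last p c = q & sorted slope_lt (step_refls p c)].
Proof.
move=> qt pq; have [|c [cp cq csub]] := @count_paths_chain L p q L_refl.
  by rewrite count_paths1.
exists c; split=> //; apply: (subseq_sorted _ csub L_sorted).
by move=> y x z; exact: lt_trans.
Qed.

Lemma increasing_chain_unique p c c' : last p c <=B top ->
  path bruhat_cover p c -> path bruhat_cover p c' -> last p c = last p c' ->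
  sorted slope_lt (step_refls p c) -> sorted slope_lt (step_refls p c') -> c = c'.
Proof.
move=> ct pc pc' E sc sc'; apply: (@chain_unique L p c c') => //.
- by rewrite count_paths1 //; exact: chain_le.
- by apply: sorted_subseq_L => //; exact: chain_refls_L.
- by apply: sorted_subseq_L => //; apply: chain_refls_L; rewrite -?E.
Qed.

Hypothesis L_inj : {in L &, injective slope}.

(** Let z0 be the cover of p below q with the least label. If the increasing
    chain from z0 to q does not extend the step to z0, its first label is
    smaller than that of z0. The first two steps then form a decreasing chain,
    whose interval also has an increasing chain; by the choice of z0 both labels
    of the latter exceed those of the former, against [rank2_slopes]. *)
Lemma increasing_chain_first p z c z' : last p (z :: c) <=B top ->
  path bruhat_cover p (z :: c) -> sorted slope_lt (step_refls p (z :: c)) ->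
  bruhat_cover p z' -> z' <=B last p (z :: c) ->
  (slope (p^-1 * z) <= slope (p^-1 * z'))%R.
Proof.
set q := last p _ => qt pc sc.
have cover_L v : bruhat_cover p v -> v <=B q -> p^-1 * v \in L.
  move=> pv vq; have vt := bruhat_trans vq qt.
  apply: L_all => //; first exact: bruhat_trans (bruhat_cover_le pv) vt.
  by case/andP: pv => /asboolP.
suff least z0 : bruhat_cover p z0 -> z0 <=B q ->
    (forall v, bruhat_cover p v -> v <=B q ->
      (slope (p^-1 * z0) <= slope (p^-1 * v))%R) -> z0 = z.
  pose C := [seq t <- L | `[< bruhat_cover p (p * t) /\ p * t <=B q >]].
  have CP v : bruhat_cover p v -> v <=B q -> p^-1 * v \in C.
    move=> pv vq; rewrite mem_filter cover_L // andbT mulVKg.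
    by apply/asboolP.
  move=> pz' z'q; have := CP z' pz' z'q.
  have [t tC t_min] : exists2 t, t \in C & forall t', t' \in C -> (slope t <= slope t')%R.
    have : sorted slope_lt C.
      by apply: sorted_filter L_sorted; move=> y x w; exact: lt_trans.
    have := CP z' pz' z'q; case: (C) => // t C' _ /= /order_path_min t_lt.
    exists t => [|t']; first exact: mem_head.
    rewrite inE => /predU1P[->//|t'C]; apply: ltW.
    by have /allP/(_ t' t'C) := t_lt (fun y x w => @lt_trans _ _ (slope y) (slope x) (slope w)).
  move: (tC); rewrite mem_filter => /andP[/asboolP[pt tq] _].
  have <- : p * t = z.
    by apply: least => // v pv vq; rewrite mulKg; apply: t_min; exact: CP.
  by rewrite mulKg; apply: t_min; exact: CP.
move=> pz0 z0q z0_min.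
have [d [pd dq sd]] := increasing_chain_exists qt z0q.
have [asc|] := boolP (sorted slope_lt (step_refls p (z0 :: d))).
  have [] // : z :: c = z0 :: d.
  by apply: (@increasing_chain_unique p) => //; rewrite /= ?pz0 // dq.
case: d pd dq sd => [//|v d] /= /andP[zv vd] dq sd.
rewrite sd andbT -leNgt => v_le.
have vq : v <=B q by rewrite -dq; exact: chain_le.
have vt := bruhat_trans vq qt.
have pv : p <=B v by exact: bruhat_trans (bruhat_cover_le pz0) (bruhat_cover_le zv).
have [e [pe ev se]] := increasing_chain_exists vt pv.
have se2 : size e = 2.
  have := chain_len pe; rewrite ev.
  have [_ [_ _ ->]] := bruhat_coverP _ _ zv.
  by have [_ [_ _ ->]] := bruhat_coverP _ _ pz0; lia.
case: e pe ev se se2 => [|x [|y [|]]] //= /and3P[px xy _] yv /andP[lt_xy _] _.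
rewrite yv {y yv} in xy lt_xy.
have xq : x <=B q by exact: bruhat_trans (bruhat_cover_le xy) vq.
have := z0_min x px xq; rewrite le_eqVlt => /predU1P[E|lt_zx].
  have {}E : z0 = x by apply: (mulgI p^-1); apply: L_inj => //; exact: cover_L.
  by have := lt_le_trans lt_xy; rewrite -E => /(_ _ v_le); rewrite ltxx.
have [r1 [rr1 Ez0 lz0]] := bruhat_coverP _ _ pz0.
have [r2 [rr2 Ev lv]] := bruhat_coverP _ _ zv.
have [r3 [rr3 Ex lx]] := bruhat_coverP _ _ px.
have [r4 [rr4 Ev' lv']] := bruhat_coverP _ _ xy.
have e1 : p^-1 * z0 = r1 by rewrite Ez0 mulKg.
have e2 : z0^-1 * v = r2 by rewrite Ev mulKg.
have e3 : p^-1 * x = r3 by rewrite Ex mulKg.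
have e4 : x^-1 * v = r4 by rewrite Ev' mulKg.
rewrite e1 ?e2 e3 ?e4 in lt_zx v_le lt_xy.
exfalso; apply: (@rank2_slopes f p r1 r2 r3 r4) => //.
- by rewrite -Ez0 lz0.
- by rewrite -Ez0 -Ev lv.
- by rewrite -Ex lx.
- by rewrite -Ex -Ev' lv'.
- by rewrite -Ez0 -Ev -Ex.
- exact: le_lt_trans v_le lt_zx.
Qed.

Lemma increasing_chain_lex p c c' : last p c <=B top ->
  path bruhat_cover p c -> path bruhat_cover p c' -> last p c = last p c' ->
  sorted slope_lt (step_refls p c) ->
  ((pairmap (fun a b => slope (a^-1 * b)) p c : seqlexi R) <=
   pairmap (fun a b => slope (a^-1 * b)) p c')%O.
Proof.
elim: c' p c => [|z' c' IH] p [|z c] // ct pc pc' E sc.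
  by have := chain_len pc; rewrite E /= => /eqP; rewrite -{1}[len p]addn0 eqn_add2l.
have z'q : z' <=B last p (z :: c).
  by rewrite E; case/andP: pc' => _; exact: chain_le.
have first := increasing_chain_first ct pc sc (proj1 (andP pc')) z'q.
rewrite /= lexi_cons first /=; apply/implyP => first'.
have Ez : z = z'.
  have zt : z <=B top by apply: bruhat_trans ct; case/andP: pc => _; exact: chain_le.
  have z't := bruhat_trans z'q ct.
  have pt : p <=B top by exact: bruhat_trans (chain_le pc) ct.
  apply: (mulgI p^-1); apply: L_inj; last by apply/le_anti/andP.
    by apply: L_all => //; case/andP: pc => /andP[/asboolP].
  by apply: L_all => //; case/andP: pc' => /andP[/asboolP].
rewrite -Ez in pc' E *; apply: IH => //.
- by case/andP: pc.
- by case/andP: pc'.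
- exact: path_sorted sc.
Qed.

End Ordered.

(** * Shifted lower intervals *)
Section ShiftedInterval.

Variables (w x : W).

Local Notation P := (shifted_lower_interval S w x).

(** The step from z to z t corresponds to multiplying z x by the conjugate of t
    by x, whose root (g x, s) has the same sign at (z x)^-1 C as that of t at
    z^-1 C. So the direction is reversed exactly if (g x, s) is a negative root,
    which means that t lowers x^-1. *)
Lemma shift_step t z : refl t -> (len z < len (z * t))%N ->
  if (len (x^-1 * t) < len x^-1)%N then z * t * x <=B z * x
  else z * x <=B z * t * x.
Proof.
move=> tt zt; have [g [s [Et gs]]] := reflP tt.
pose h := g * x; pose t' := root_refl h s.
have t't : refl t' by exact: refl_root.
have E : z * t * x = z * x * t'.
  by rewrite /t' /h root_reflM -Et conjgE !mulgA mulgK.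
have pos : (0 < root_form h s (rep (z * x)^-1 center))%R.
  move: zt; rewrite Et (strong_exchange) // !root_rep.
  by rewrite invgM /h !mulgA mulgK.
have lenE : (len (x^-1 * t) < len x^-1)%N = (len (val s * h) < len h)%N.
  rewrite len_refl // Et (strong_exchange) // root_rep invgK.
  by rewrite (root_gt0 _ _ chamber_center) len_genL_ltN.
rewrite lenE E; case: ifP => [sh|/negbT]; last first.
  rewrite -leqNgt leq_eqVlt => /orP[/eqP lh|hs].
    by have := len_genL coxS s h; lia.
  by apply: bruhat_up => //; rewrite (strong_exchange).
rewrite -[X in _ <=B X](mulg_reflK t't (z * x)); apply: bruhat_up => //.
rewrite (mulg_reflK t't) len_refl //.
have -> : t' = root_refl (val s * h) s by rewrite root_refl_neg.
rewrite (strong_exchange); last by rewrite genK.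
by rewrite root_neg -leNgt oppr_le0 ltW.
Qed.

Lemma shifted_intervalP z : P z <-> z * x <=B w.
Proof.
split=> [[v vw <-]|zw]; first by rewrite mulgVK.
by exists (z * x) => //; rewrite mulgK.
Qed.

(** This makes the reflections lowering [x^-1] an initial segment. *)
Hypothesis f_shift : forall t, refl t ->
  (slope t < 0)%R = (len (x^-1 * t) < len x^-1)%N.

Lemma ascending_chain_shift p c : path bruhat_cover p c ->
  {in step_refls p c, forall t, (0 <= slope t)%R} ->
  {in p :: c, forall z, z * x <=B last p c * x}.
Proof.
elim: c p => [|z c IH] p; first by move=> _ _ z; rewrite inE => /eqP->; exact: bruhat_refl.
move=> /andP[pz zc] pos v; rewrite inE => /predU1P[->|].
  have [t [tt Ez lz]] := bruhat_coverP _ _ pz.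
  apply: (@bruhat_trans (z * x)).
    have := @shift_step t p tt; rewrite -f_shift // ltNge -Ez lz => /(_ (leqnn _)).
    by rewrite pos // inE Ez mulKg eqxx.
  by apply: IH; rewrite ?mem_head // => u uc; apply: pos; rewrite inE uc orbT.
by apply: IH => // u uc; apply: pos; rewrite inE uc orbT.
Qed.

(** While the labels are in the initial segment, each vertex of the shifted
    chain lies below its predecessor; afterwards, all lie below the last. *)
Lemma increasing_chain_shift p c : path bruhat_cover p c ->
  sorted slope_lt (step_refls p c) -> P p -> P (last p c) ->
  {in p :: c, forall z, P z}.
Proof.
elim: c p => [|z c IH] p; first by move=> _ _ Pp _ z; rewrite inE => /eqP->.
move=> pc sc Pp Pl; have [pz zc] := andP pc.
have [t [tt Ez lz]] := bruhat_coverP _ _ pz.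
have Et : p^-1 * z = t by rewrite Ez mulKg.
have [t_neg|t_pos] := ltP (slope t) 0%R.
  move=> v; rewrite inE => /predU1P[->//|]; apply: IH => //.
    exact: path_sorted sc.
  apply/shifted_intervalP; apply: bruhat_trans (iffLR (shifted_intervalP p) Pp).
  by have := @shift_step t p tt; rewrite -f_shift // t_neg -Ez lz => /(_ (leqnn _)).
move=> v vc; apply/shifted_intervalP.
apply: bruhat_trans (iffLR (shifted_intervalP _) Pl).
apply: ascending_chain_shift => // u; rewrite inE Et => /predU1P[->//|uc].
have trans : transitive slope_lt by move=> a b d; exact: lt_trans.
move: sc; rewrite /= Et => /(order_path_min trans)/allP/(_ u uc) tu.
exact: ltW (le_lt_trans t_pos tu).
Qed.

Variables (top : W) (L : seq W).
Hypothesis P_top : forall p, P p -> p <=B top.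
Hypothesis L_refl : {in L, forall t, refl t}.
Hypothesis L_sorted : sorted slope_lt L.
Hypothesis L_all : forall y z, y <=B top -> z <=B top -> refl (y^-1 * z) ->
  y^-1 * z \in L.
Hypothesis L_inj : {in L &, injective slope}.

Lemma shifted_chain p q : P p -> P q -> p <=B q -> exists c,
  [/\ path bruhat_cover p c, last p c = q, sorted slope_lt (step_refls p c) &
      {in c, forall z, P z}].
Proof.
move=> Pp Pq pq.
have [c [pc cq sc]] := increasing_chain_exists L_refl L_sorted L_all (P_top Pq) pq.
exists c; split=> // z zc; apply: (increasing_chain_shift pc sc Pp).
  by rewrite cq.
by rewrite inE zc orbT.
Qed.

(** A cover of the shifted interval is joined by an increasing chain inside it,
    which can have only one step. *)
Lemma shifted_coversP p q : P p -> P q ->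
  covers P (bruhat S) p q <-> bruhat_cover p q.
Proof.
move=> Pp Pq; split=> [[[_ _ pq p_neq] no_mid]|pq].
  have [[|z [|v c]] [pc cq _ cP]] := shifted_chain Pp Pq pq.
  - by case: p_neq.
  - by move: pc cq; rewrite /= andbT => pz <-.
  have [pz zc] : bruhat_cover p z /\ path bruhat_cover z (v :: c) by exact/andP.
  have := chain_len zc.
  have [_ [_ _ lz]] := bruhat_coverP _ _ pz.
  rewrite [last _ _]cq /= => lq; case: (no_mid z).
  have Pz : P z by apply: cP; rewrite mem_head.
  split; split=> //; [exact: bruhat_cover_le pz| | |] => [E||E].
  - by move: lz; rewrite E; lia.
  - by rewrite -cq; exact: chain_le zc.
  - by move: lq; rewrite E; lia.
have [_ [_ _ lq]] := bruhat_coverP _ _ pq.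
split.
  by split=> //; [exact: bruhat_cover_le|move=> E; move: lq; rewrite E; lia].
move=> z [[_ _ /bruhat_len[//|pz] _] [_ _ /bruhat_len[//|zq] _]].
by lia.
Qed.

Lemma shifted_maximal_chain p q c : maximal_chain P (bruhat S) p q c ->
  path bruhat_cover p c /\ last p c = q.
Proof.
move=> [pc cq]; split=> //; apply: sub_path pc => y z /asboolP yz.
by case: (yz) => -[Py Pz _ _] _; apply/(shifted_coversP Py Pz).
Qed.

Lemma maximal_chain_shifted p c : P p -> {in c, forall z, P z} ->
  path bruhat_cover p c -> maximal_chain P (bruhat S) p (last p c) c.
Proof.
move=> Pp cP pc; split=> //; elim: c p Pp cP pc => //= z c IH p Pp cP.
have Pz : P z by apply: cP; rewrite mem_head.
move=> /andP[pz zc]; rewrite IH //; last by move=> v vc; apply: cP; rewrite inE vc orbT.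
by rewrite andbT; apply/asboolP/(shifted_coversP Pp Pz).
Qed.

Lemma shifted_EL_labeling :
  EL_labeling P (bruhat S) (fun p q => slope (p^-1 * q)).
Proof.
have incE p c : increasing_chain (fun p q => slope (p^-1 * q)) p c <->
    sorted slope_lt (step_refls p c).
  rewrite /increasing_chain /label_seq.
  have -> : pairmap (fun a b => slope (a^-1 * b)) p c =
      [seq slope t | t <- step_refls p c].
    by elim: c p => //= z c IH p; rewrite IH.
  by rewrite sorted_map.
move=> p q Pp Pq pq; have [c [pc cq sc cP]] := shifted_chain Pp Pq pq.
have qt : last p c <=B top by rewrite cq; exact: P_top.
exists c; split.
- by rewrite -cq; exact: maximal_chain_shifted.
- exact/incE.
- move=> c' /shifted_maximal_chain[pc' c'q] /incE sc'.
  apply: (increasing_chain_unique L_refl L_sorted L_all _ pc' pc _ sc' sc).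
    by rewrite c'q; exact: P_top.
  by rewrite c'q cq.
- move=> c' /shifted_maximal_chain[pc' c'q].
  by apply: (increasing_chain_lex L_refl L_sorted L_all L_inj qt pc pc' _ sc); rewrite cq.
Qed.

End ShiftedInterval.

End Labels.

End ReflectionOrder.

Theorem theorem1p1 (W : groupType) (S : set W) (w x : W) :
  coxeter_system S ->
  EL_shellable (shifted_lower_interval S w x) (bruhat S).
Proof.
move=> coxS; have [G] := geometric_rep_exists Rdefinitions.R coxS.
have [b [top [b_min top_max]]] := shifted_interval_bounds coxS G w x^-1.
have [K KP] := lower_interval_finite coxS G top.
pose L0 := [seq t <- [seq y^-1 * z | y <- K, z <- K] | `[< reflections S t >]].
have L0_refl : {in L0, forall t, reflections S t}.
  by move=> t; rewrite mem_filter => /andP[/asboolP].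
have [f [f_shift f_inj]] := generic_slope coxS G x^-1 L0_refl.
pose L := sort (relpre (slope_at G f) <=%R) (undup L0).
have L_L0 t : (t \in L) = (t \in L0) by rewrite mem_sort mem_undup.
have L_refl : {in L, forall t, reflections S t} by move=> t; rewrite L_L0; exact: L0_refl.
have L_inj : {in L &, injective (slope_at G f)}.
  by move=> t1 t2; rewrite !L_L0; exact: f_inj.
have L_sorted : sorted (fun t t' => slope_at G f t < slope_at G f t')%R L.
  suff : sorted <%R (map (slope_at G f) L) by rewrite sorted_map.
  rewrite lt_sorted_uniq_le map_inj_in_uniq // sort_uniq undup_uniq sorted_map.
  by apply: sort_sorted => t t'; exact: le_total.
have L_all y z : bruhat S y top -> bruhat S z top -> reflections S (y^-1 * z) ->
    y^-1 * z \in L.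
  move=> /KP yK /KP zK yz; rewrite L_L0 mem_filter; apply/andP; split.
    exact/asboolP.
  by apply/allpairsP; exists (y, z).
have EL := shifted_EL_labeling coxS f_shift top_max.2 L_refl L_sorted L_all L_inj.
split.
- split=> [p _|p q _ _|p q r _ _ _]; first exact: bruhat_refl.
    exact: bruhat_anti.
  exact: bruhat_trans.
- apply: (@sub_finite_set _ _ [set` K]) => // p Pp.
  by apply: KP; exact: top_max.2.
- exists b, top; split=> // c c'.
  have maxP := shifted_maximal_chain coxS f_shift top_max.2 L_refl L_sorted L_all.
  move=> /maxP[pc cq] /maxP[pc' c'q].
  by have := chain_len pc; rewrite cq -c'q (chain_len pc') => /addnI.
- by exists _, _, (fun p q => slope_at G f (p^-1 * q)).
Qed.
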